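(* Let $d\in\mathbb{N}$ and let $M$ be a nonempty subset of $\mathbb{R}^d$. Then the Lipschitz-free space $\mathcal{F}(M)$ has the Dunford--Pettis property.
   Context: $\mathbb{R}^d$ and all of its subsets carry the Euclidean metric. Lipschitz-free space: given a metric space $M$ with a basepoint $0_M\in M$, $\mathrm{Lip}_0(M)$ denotes the Banach space of Lipschitz functions $f:M\to\mathbb{R}$ with $f(0_M)=0$, normed by the Lipschitz norm (the best Lipschitz constant). For $x\in M$, let $\delta_M(x)\in \mathrm{Lip}_0(M)^*$ be the evaluation $\delta_M(x)(f)=f(x)$. The Lipschitz-free space over $M$ is $\mathcal{F}(M)=\overline{\mathrm{span}}^{\|\cdot\|}\{\delta_M(x):x\in M\}\subset \mathrm{Lip}_0(M)^*$. Up to isometric isomorphism it does not depend on the choice of basepoint. Dunford--Pettis property: a Banach space $X$ has the Dunford--Pettis property if for every weakly null sequence $(x_n)_{n=1}^\infty$ in $X$ and every weakly null sequence $(f_n)_{n=1}^\infty$ in the dual $X^*$ (null for the weak topology $\sigma(X^*,X^{**})$), one has $f_n(x_n)\to 0$ as $n\to\infty$. *)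

(* Defs.v *)
From HB Require Import structures.
From mathcomp Require Import all_boot all_order all_algebra.
From mathcomp Require Import all_classical all_reals all_analysis.
From mathcomp Require Import ring.

Set Implicit Arguments.
Unset Strict Implicit.
Unset Printing Implicit Defensive.

Import Order.TTheory GRing.Theory Num.Theory.
Import numFieldNormedType.Exports.

Local Open Scope classical_set_scope.
Local Open Scope ring_scope.

Section dual_space.
Context {R : realType} (V : normedModType R).

Definition dual_pred : {pred V -> R^o} :=
  mem [set f : V -> R^o | linear f /\ continuous f].

Record dual_space := DualSpace {
  dual_val :> V -> R^o ;
  dual_valP : dual_val \in dual_pred }.

HB.instance Definition _ := [isSub for dual_val].
HB.instance Definition _ := [Choice of dual_space by <:].

Lemma dual_submod_closed : submod_closed dual_pred.
Proof.
split.
  rewrite inE; split; last exact: cst_continuous.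
  by move=> a x y; rewrite /= scaler0 addr0.
move=> a f g; rewrite !inE => -[lf cf] [lg cg]; split.
  move=> b x y; rewrite -[LHS]/(a *: f (b *: x + y) + g (b *: x + y)) lf lg.
  rewrite -[RHS]/(b *: (a *: f x + g x) + (a *: f y + g y)).
  by rewrite !scalerDr !scalerA addrACA (mulrC a b).
by move=> x; apply: cvgD; [apply: cvgZr; exact: cf|exact: cg].
Qed.

HB.instance Definition _ :=
  GRing.isSubmodClosed.Build R (V -> R^o) dual_pred dual_submod_closed.
HB.instance Definition _ := [SubChoice_isSubLmodule of dual_space by <:].

Lemma dual_linear (f : dual_space) : linear (f : V -> R^o).
Proof. by have := dual_valP f; rewrite inE => -[]. Qed.

HB.instance Definition _ (f : dual_space) :=
  GRing.isLinear.Build R V R^o *:%R (dual_val f) (dual_linear f).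

Lemma dual_continuous (f : dual_space) : continuous (f : V -> R^o).
Proof. by have := dual_valP f; rewrite inE => -[]. Qed.

Lemma dualP (f g : dual_space) : f =1 g -> f = g.
Proof. by move=> fg; apply/val_inj/funext. Qed.

Definition dual_norm (f : dual_space) : R :=
  sup [set `|f x| | x in [set x : V | `|x| <= 1]].

Lemma dual_bounded (f : dual_space) : exists2 C : R, 0 < C &
  forall x, `|f x| <= C * `|x|.
Proof.
have /linear_bounded_continuous/linear_boundedP := @dual_continuous f.
by move=> /pinfty_ex_gt0.
Qed.

Lemma dual_has_sup (f : dual_space) :
  has_sup [set `|f x| | x in [set x : V | `|x| <= 1]].
Proof.
split; first by exists `|f 0|, 0 => //=; rewrite normr0.
have [C C0 fC] := dual_bounded f.
exists C => _ [x /= x1 <-]; rewrite (le_trans (fC x))// ger_pMr//.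
Qed.

Lemma dual_norm_ge0 (f : dual_space) : 0 <= dual_norm f.
Proof.
apply: (@le_trans _ _ `|f 0|) => //.
by apply: (sup_upper_bound (dual_has_sup f)); exists 0 => //=; rewrite normr0.
Qed.

Lemma le_dual_norm (f : dual_space) x : `|f x| <= dual_norm f * `|x|.
Proof.
have [->|x0] := eqVneq x 0; first by rewrite linear0 !normr0 mulr0.
have nx0 : 0 < `|x| by rewrite normr_gt0.
rewrite -ler_pdivrMr// mulrC.
rewrite -[X in X * _]ger0_norm ?invr_ge0// -normrM -[_ * _]linearZ/=.
apply: (sup_upper_bound (dual_has_sup f)).
by exists (`|x|^-1 *: x) => //=; rewrite normfZV.
Qed.

Lemma dual_norm_le (f : dual_space) (C : R) : 0 <= C -> (forall x, `|f x| <= C * `|x|) ->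
  dual_norm f <= C.
Proof.
move=> C0 fC; apply: ge_sup; first exact: (dual_has_sup f).1.
by move=> _ [x /= x1 <-]; rewrite (le_trans (fC x))// ler_piMr.
Qed.

Lemma dual_normD (f g : dual_space) : dual_norm (f + g) <= dual_norm f + dual_norm g.
Proof.
apply: dual_norm_le => [|x]; first by rewrite addr_ge0// dual_norm_ge0.
rewrite mulrDl (le_trans (ler_normD (f x) (g x)))//.
by rewrite lerD// le_dual_norm.
Qed.

Lemma dual_normZ (a : R) (f : dual_space) : dual_norm (a *: f) = `|a| * dual_norm f.
Proof.
have leZ b g : dual_norm (b *: g) <= `|b| * dual_norm g.
  apply: dual_norm_le => [|x]; first by rewrite mulr_ge0// dual_norm_ge0.
  by rewrite -mulrA -[(b *: g) x]/(b * g x) normrM ler_wpM2l// le_dual_norm.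
apply/eqP; rewrite eq_le leZ/=; have [->|a0] := eqVneq a 0.
  by rewrite normr0 mul0r dual_norm_ge0.
rewrite -ler_pdivlMl ?normr_gt0// -normfV (le_trans _ (leZ _ _))//.
by rewrite scalerA mulVf// scale1r.
Qed.

Lemma dual_norm0_eq0 (f : dual_space) : dual_norm f = 0 -> f = 0.
Proof.
move=> f0; apply: dualP => x; apply/eqP; rewrite -normr_le0.
by rewrite (le_trans (le_dual_norm f x))// f0 mul0r.
Qed.

HB.instance Definition _ := Lmodule_isNormed.Build R dual_space
  dual_normD dual_normZ dual_norm0_eq0.

Lemma dual_complete (F : set_system dual_space) :
  ProperFilter F -> cauchy F -> cvg F.
Proof.
move=> FF /cauchy_ballP F_cauchy.
have {}F_cauchy e : 0 < e -> \forall g & h \near F, `|g - h| < e.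
  by move=> e0; have := F_cauchy e e0; rewrite -ball_normE.
have Fx x : cvg ((dual_val^~ x : dual_space -> R) @ F).
  apply: R_complete; apply/cauchy_exP => e e0.
  have d0 : 0 < e / (`|x| + 1) by rewrite divr_gt0// ltr_pwDr.
  near F => g; exists (g x).
  change (F [set h : dual_space | ball (g x : R) e (h x)]).
  near=> h; rewrite /ball/=.
  rewrite -[_ - _]/((g - h) x) (le_lt_trans (le_dual_norm _ _))//.
  rewrite -[dual_norm _]/(`|g - h|).
  rewrite (@le_lt_trans _ _ (`|g - h| * (`|x| + 1)))//.
    by rewrite ler_wpM2l// lerDl.
  rewrite -ltr_pdivlMr// ?ltr_pwDr//.
  by near: h; near: g; apply: nearP_dep; exact: F_cauchy.
pose l x : R^o := lim ((dual_val^~ x : dual_space -> R) @ F).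
have Fl x : (dual_val^~ x : dual_space -> R) @ F --> l x by exact: Fx.
have close e : 0 < e ->
    F [set g : dual_space | forall x, `|l x - g x| <= e * `|x|].
  move=> e0; near=> g => x; apply/ler_addgt0Pr => eps eps0.
  near F => h.
  rewrite -(subrKA (h x)) (le_trans (ler_normD _ _))// addrC lerD//.
    rewrite -[_ - _]/((h - g) x) (le_trans (le_dual_norm _ _))//.
    rewrite ler_wpM2r// -[dual_norm _]/(`|h - g|) distrC ltW//.
    by near: h; near: g; apply: nearP_dep; exact: F_cauchy.
  by near: h; exact: (@cvgr_dist_le _ _ _ _ _ _ _ (Fl x) eps eps0).
have ll : linear l.
  move=> a x y; apply: cvg_lim => //.
  rewrite (_ : dual_val^~ (a *: x + y) =
    (fun g : dual_space => a *: (g x : R^o) + g y)); last first.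
    by apply/funext => g; rewrite linearP.
  by apply: cvgD; [apply: cvgZr; exact: Fl|exact: Fl].
pose lL : {linear V -> R^o} := HB.pack l (GRing.isLinear.Build R V R^o *:%R l ll).
have lc : continuous l.
  apply: (@bounded_linear_continuous _ _ _ lL); apply/linear_boundedP.
  near F => g; have lg : forall x, `|l x - g x| <= 1 * `|x|.
    by near: g; exact: close.
  near=> r => x; rewrite -[_ x](subrK (g x)) (le_trans (ler_normD _ _))//.
  rewrite (le_trans (lerD (lg x) (le_dual_norm g x)))// -mulrDl ler_wpM2r//.
have lP : l \in dual_pred by rewrite inE.
apply/cvg_ex; exists (DualSpace lP); apply/cvgrPdist_le => e e0.
near=> g; apply: dual_norm_le => [|x]; first exact: ltW.
by move: x; near: g; exact: close.
Unshelve. all: by end_near. Qed.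

HB.instance Definition _ := Uniform_isComplete.Build dual_space dual_complete.

End dual_space.

(* Convergence to 0 for sigma(V, V^* ). When V is itself the dual of X, the
   functionals range over the bidual, so this is sigma(X^*, X^** ). *)
Definition weakly_null {R : realType} {V : normedModType R} (x : V^nat) :=
  forall f : dual_space V, f (x n) @[n --> \oo] --> (0 : R).

Definition dunford_pettis {R : realType} (V : completeNormedModType R) :=
  forall (x : V^nat) (f : (dual_space V)^nat),
    weakly_null x -> weakly_null f ->
    f n (x n) @[n --> \oo] --> (0 : R).

(* R^d with the Euclidean metric; an alias, because 'rV[R]_d already carries
   the metric of the sup norm. *)
Definition euclidean (R : realType) (d : nat) := 'rV[R]_d.

Section euclidean.
Context {R : realType} {d : nat}.
Implicit Types x y z : euclidean R d.

HB.instance Definition _ := Choice.on (euclidean R d).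

Definition euclidean_dist x y : R :=
  Num.sqrt (\sum_(i < d) (x 0 i - y 0 i) ^+ 2).

Lemma euclidean_distxx x : euclidean_dist x x = 0.
Proof.
rewrite /euclidean_dist big1 ?sqrtr0// => i _.
by rewrite subrr expr0n.
Qed.

Lemma euclidean_dist_positivity x y : euclidean_dist x y = 0 -> x = y.
Proof.
move/eqP; rewrite sqrtr_eq0 => le0; apply/rowP => i; apply/eqP.
rewrite -subr_eq0 -sqrf_eq0 -[_ == 0]andTb eq_le sqr_ge0 andbT.
apply: le_trans le0; rewrite (bigD1 i)//= lerDl.
by apply: sumr_ge0 => j _; exact: sqr_ge0.
Qed.

Lemma euclidean_dist_sym x y : euclidean_dist x y = euclidean_dist y x.
Proof.
by congr Num.sqrt; apply: eq_bigr => i _; rewrite -sqrrN opprB.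
Qed.

Lemma sum_cauchy_schwarz (a b : 'I_d -> R) : (\sum_i a i * b i) ^+ 2 <=
  (\sum_i a i ^+ 2) * (\sum_i b i ^+ 2).
Proof.
have : 0 <= \sum_i \sum_j (a i * b j - a j * b i) ^+ 2.
  by apply: sumr_ge0 => i _; apply: sumr_ge0 => j _; exact: sqr_ge0.
suff -> : \sum_i \sum_j (a i * b j - a j * b i) ^+ 2 =
    ((\sum_i a i ^+ 2) * (\sum_i b i ^+ 2) - (\sum_i a i * b i) ^+ 2) *+ 2.
  by rewrite pmulrn_lge0// subr_ge0.
rewrite mulrnBl mulr2n {2}[_ * _]mulrC expr2 !big_distrlr/= -!big_split/=.
rewrite -sumrMnl -sumrB; apply: eq_bigr => i _.
rewrite -!big_split/= -sumrMnl -sumrB; apply: eq_bigr => j _.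
by ring.
Qed.

Lemma euclidean_dist_triangle y x z :
  euclidean_dist x z <= euclidean_dist x y + euclidean_dist y z.
Proof.
rewrite /euclidean_dist.
pose a i := x 0 i - y 0 i; pose b i := y 0 i - z 0 i.
rewrite -[leLHS](_ : Num.sqrt (\sum_i (a i + b i) ^+ 2) = _); last first.
  by congr Num.sqrt; apply: eq_bigr => i _; rewrite /a /b subrKA.
rewrite -[X in X + _]/(Num.sqrt (\sum_i a i ^+ 2)).
rewrite -[X in _ + X]/(Num.sqrt (\sum_i b i ^+ 2)).
have sq0 (c : 'I_d -> R) : 0 <= \sum_i c i ^+ 2.
  by apply: sumr_ge0 => i _; exact: sqr_ge0.
rewrite -ler_sqr ?nnegrE ?addr_ge0 ?sqrtr_ge0//.
rewrite sqrrD !sqr_sqrtr//.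
have -> : \sum_i (a i + b i) ^+ 2 =
    \sum_i a i ^+ 2 + (\sum_i a i * b i) *+ 2 + \sum_i b i ^+ 2.
  rewrite -sumrMnl -!big_split/=; apply: eq_bigr => i _.
  by rewrite sqrrD.
rewrite lerD2r lerD2l lerMn2r/=.
rewrite -sqrtrM// (le_trans (ler_norm _))// -sqrtr_sqr ler_wsqrtr//.
exact: sum_cauchy_schwarz.
Qed.

HB.instance Definition _ := isMetric.Build R (euclidean R d)
  euclidean_distxx euclidean_dist_positivity euclidean_dist_sym
  euclidean_dist_triangle.

End euclidean.

Section subset_metric.
Context {R : realType} {X : metricType R} (A : set X).

Let subset_dist (x y : A) : R := mdist (set_val x) (set_val y).

Let subset_dist_ge0 x y : 0 <= subset_dist x y.
Proof. exact: mdist_ge0. Qed.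

Let subset_dist_positivity x y : subset_dist x y = 0 -> x = y.
Proof. by move/mdist_positivity/val_inj. Qed.

Let subset_ballE (x : A) (e : R) : ball x e = [set y | subset_dist x y < e].
Proof.
apply/seteqP; split => y; rewrite /ball/= /subset_dist.
  by rewrite /initial_ball /= ballEmdist.
by rewrite /initial_ball /= ballEmdist.
Qed.

HB.instance Definition _ := PseudoMetric_isMetric.Build R (set_type A)
  subset_dist_ge0 subset_dist_positivity subset_ballE.

End subset_metric.

Section lip0.
Context {R : realType} {T : metricType R} (o : T).

Definition lipschitz_const (f : T -> R^o) : set R :=
  [set k | 0 <= k /\ forall x y, `|f x - f y| <= k * mdist x y].

Definition lip0_pred : {pred T -> R^o} :=
  mem [set f : T -> R^o | lipschitz_const f !=set0 /\ f o = 0].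

(* Lip_0(T) for the base point o. *)
Record lip0 := Lip0 {
  lip0_val :> T -> R^o ;
  lip0_valP : lip0_val \in lip0_pred }.

HB.instance Definition _ := [isSub for lip0_val].
HB.instance Definition _ := [Choice of lip0 by <:].

Lemma lipschitz_constD f g k l : lipschitz_const f k -> lipschitz_const g l ->
  lipschitz_const (f + g) (k + l).
Proof.
move=> [k0 fk] [l0 gl]; split=> [|x y]; first exact: addr_ge0.
rewrite -[_ - _]/((f x + g x) - (f y + g y)) opprD addrACA mulrDl.
by rewrite (le_trans (ler_normD _ _))// lerD.
Qed.

Lemma lipschitz_constZ a f k : lipschitz_const f k ->
  lipschitz_const (a *: f) (`|a| * k).
Proof.
move=> [k0 fk]; split=> [|x y]; first exact: mulr_ge0.
rewrite -[_ - _]/(a *: f x - a *: f y) -scalerBr normrZ -mulrA.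
by rewrite ler_wpM2l.
Qed.

Lemma lip0_submod_closed : submod_closed lip0_pred.
Proof.
split.
  rewrite inE; split => //; exists 0; split => // x y.
  by rewrite subrr normr0 mul0r.
move=> a f g; rewrite !inE => -[[k fk] f0] [[l gl] g0]; split.
  by exists (`|a| * k + l); apply: lipschitz_constD => //; exact: lipschitz_constZ.
by rewrite -[LHS]/(a *: f o + g o) f0 g0 scaler0 addr0.
Qed.

HB.instance Definition _ :=
  GRing.isSubmodClosed.Build R (T -> R^o) lip0_pred lip0_submod_closed.
HB.instance Definition _ := [SubChoice_isSubLmodule of lip0 by <:].

(* The best Lipschitz constant of f. *)
Definition lip0_norm (f : lip0) : R := inf (lipschitz_const f).

Lemma lip0_has_lipschitz_const (f : lip0) : lipschitz_const f !=set0.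
Proof. by have := lip0_valP f; rewrite inE => -[]. Qed.

Lemma lip0_base (f : lip0) : f o = 0.
Proof. by have := lip0_valP f; rewrite inE => -[]. Qed.

Lemma lip0_norm_le (f : lip0) k : lipschitz_const f k -> lip0_norm f <= k.
Proof. by move=> fk; apply: ge_inf => //; exists 0 => l []. Qed.

Lemma lip0_norm_const (f : lip0) : lipschitz_const f (lip0_norm f).
Proof.
split; first by apply: lb_le_inf; [exact: lip0_has_lipschitz_const|move=> k []].
move=> x y; have [->|xy] := eqVneq x y.
  by rewrite subrr normr0 mdistxx mulr0.
rewrite -ler_pdivrMr ?mdist_gt0//.
apply: lb_le_inf; first exact: lip0_has_lipschitz_const.
by move=> k [_ fk]; rewrite ler_pdivrMr ?mdist_gt0.
Qed.

Lemma lip0_normD (f g : lip0) : lip0_norm (f + g) <= lip0_norm f + lip0_norm g.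
Proof.
by apply: lip0_norm_le; apply: lipschitz_constD; exact: lip0_norm_const.
Qed.

Lemma lip0_normZ (a : R) (f : lip0) : lip0_norm (a *: f) = `|a| * lip0_norm f.
Proof.
have leZ b (g : lip0) : lip0_norm (b *: g) <= `|b| * lip0_norm g.
  by apply: lip0_norm_le; apply: lipschitz_constZ; exact: lip0_norm_const.
apply/eqP; rewrite eq_le leZ/=; have [->|a0] := eqVneq a 0.
  by rewrite normr0 mul0r; exact: (lip0_norm_const _).1.
rewrite -ler_pdivlMl ?normr_gt0// -normfV (le_trans _ (leZ _ _))//.
by rewrite scalerA mulVf// scale1r.
Qed.

Lemma lip0_norm0_eq0 (f : lip0) : lip0_norm f = 0 -> f = 0.
Proof.
move=> f0; apply/val_inj/funext => x; apply/eqP; rewrite -normr_le0.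
have [_ /(_ x o)] := lip0_norm_const f.
by rewrite f0 mul0r lip0_base subr0.
Qed.

HB.instance Definition _ := Lmodule_isNormed.Build R lip0
  lip0_normD lip0_normZ lip0_norm0_eq0.

Lemma evaluation_in_dual (x : T) :
  (fun f : lip0 => f x : R^o) \in @dual_pred R lip0.
Proof.
rewrite inE.
have lev : linear (fun f : lip0 => f x : R^o) by [].
split => //.
pose ev : {linear lip0 -> R^o} :=
  HB.pack (fun f : lip0 => f x : R^o) (GRing.isLinear.Build R lip0 R^o *:%R _ lev).
apply: (@bounded_linear_continuous _ _ _ ev); apply/linear_boundedP.
near=> r => f; rewrite /= -[f x]subr0 -(lip0_base f).
rewrite (le_trans ((lip0_norm_const f).2 x o))// mulrC.
rewrite -[lip0_norm f]/(`|f|) ler_wpM2r//.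
Unshelve. all: by end_near. Qed.

Definition evaluation (x : T) : dual_space lip0 :=
  DualSpace (evaluation_in_dual x).

End lip0.

Definition linear_span {R : realType} {V : normedModType R} (A : set V) : set V :=
  [set v | exists (n : nat) (c : 'I_n -> R) (a : 'I_n -> V),
    (forall i, A (a i)) /\ v = \sum_(i < n) c i *: a i].

Section free_space.
Context {R : realType} {T : metricType R} (o : T).

Definition free_pred : {pred dual_space (lip0 o)} :=
  mem (closure (linear_span (range (evaluation o)))).

(* The Lipschitz-free space over T with base point o, normed as a subspace of
   the dual of Lip_0(T). *)
Record free_space := FreeSpace {
  free_val : dual_space (lip0 o) ;
  free_valP : free_val \in free_pred }.

HB.instance Definition _ := [isSub for free_val].
HB.instance Definition _ := [Choice of free_space by <:].

Lemma free_predP v : (v \in free_pred) <-> forall e : R, 0 < e ->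
  exists2 w, linear_span (range (evaluation o)) w & `|v - w| < e.
Proof.
rewrite inE; split=> [cv e e0|cv B].
  have [w [sw]] := cv _ (nbhsx_ballx v e e0).
  by rewrite -ball_normE /= => vw; exists w.
move=> /nbhs_ballP[e /= e0 eB]; have [w sw vw] := cv _ e0.
by exists w; split => //; apply: eB; rewrite -ball_normE.
Qed.

Lemma linear_spanP a (v w : dual_space (lip0 o)) :
  linear_span (range (evaluation o)) v ->
  linear_span (range (evaluation o)) w ->
  linear_span (range (evaluation o)) (a *: v + w).
Proof.
move=> [n [c [x [xT ->]]]] [m [c' [y [yT ->]]]].
exists (n + m)%N.
exists (fun i => match fintype.split i with inl j => a * c j | inr j => c' j end).
exists (fun i => match fintype.split i with inl j => x j | inr j => y j end).
split; first by move=> i; case: (fintype.split i).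
rewrite big_split_ord/= scaler_sumr; congr (_ + _); apply: eq_bigr => i _.
  by case: splitP => j /= ij; [rewrite scalerA; congr (_ * c _ *: x _); exact: val_inj
    |have := ltn_ord i; rewrite ij ltnNge leq_addr].
case: splitP => j /= ij; first by have := ltn_ord j; rewrite -ij ltnNge leq_addr.
by have -> : i = j by apply: val_inj; exact: (addnI ij).
Qed.

Lemma free_submod_closed : submod_closed free_pred.
Proof.
split.
  apply/free_predP => e e0; exists 0; last by rewrite subrr normr0.
  by exists 0%N, (fun=> 0), (fun=> 0); split; [case|rewrite big_ord0].
move=> a v w /free_predP vP /free_predP wP; apply/free_predP => e e0.
have a0 : 0 < `|a| + 1 by rewrite ltr_wpDl.
have [v' v's vv'] := vP (e / 2 / (`|a| + 1)) (divr_gt0 (divr_gt0 e0 (ltr0Sn _ 1)) a0).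
have [w' w's ww'] := wP (e / 2) (divr_gt0 e0 (ltr0Sn _ 1)).
exists (a *: v' + w'); first exact: linear_spanP.
rewrite opprD addrACA -scalerBr (le_lt_trans (ler_normD _ _))//.
rewrite normrZ [ltRHS]splitr ler_ltD//.
rewrite (@le_trans _ _ ((`|a| + 1) * `|v - v'|))//.
  by rewrite ler_wpM2r// lerDl.
by rewrite mulrC -ler_pdivlMr// ltW.
Qed.

HB.instance Definition _ := GRing.isSubmodClosed.Build R
  (dual_space (lip0 o)) free_pred free_submod_closed.
HB.instance Definition _ := [SubChoice_isSubLmodule of free_space by <:].

Definition free_norm (v : free_space) : R := `|free_val v|.

Lemma free_normD (v w : free_space) :
  free_norm (v + w) <= free_norm v + free_norm w.
Proof. exact: ler_normD. Qed.

Lemma free_normZ (a : R) (v : free_space) :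
  free_norm (a *: v) = `|a| * free_norm v.
Proof. exact: normrZ. Qed.

Lemma free_norm0_eq0 (v : free_space) : free_norm v = 0 -> v = 0.
Proof. by move/normr0_eq0 => v0; exact: val_inj. Qed.

HB.instance Definition _ := Lmodule_isNormed.Build R free_space
  free_normD free_normZ free_norm0_eq0.

Lemma free_complete (F : set_system free_space) :
  ProperFilter F -> cauchy F -> cvg F.
Proof.
move=> FF /cauchyP F_cauchy.
have /cauchy_cvg/cvg_ex[/= l Fl] : cauchy (free_val @ F).
  apply/cauchy_exP => e e0; have [v Fv] := F_cauchy e e0.
  exists (free_val v).
  change (F [set w : free_space | ball (free_val v) e (free_val w)]).
  by apply: filterS Fv => w; rewrite -!ball_normE.
have lP : l \in free_pred.
  rewrite inE; apply: (closed_cvg (u_ := free_val) (F := F) _ _ _ _ Fl).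
    exact: closed_closure.
  by apply: nearW => v; have := free_valP v; rewrite inE.
apply/cvg_ex; exists (FreeSpace lP); apply/cvgrPdist_lt => e e0.
by have /cvgrPdist_lt/(_ e e0) := Fl.
Qed.

HB.instance Definition _ := Uniform_isComplete.Build free_space free_complete.

End free_space.

(* Main.v *)
Require Import Defs.
From HB Require Import structures.
From mathcomp Require Import all_boot all_order all_algebra.
From mathcomp Require Import all_classical all_reals all_analysis.
From mathcomp Require Import ring lra zify.

(* Let [v n] be weakly null in the free space and [F n] weakly null in its dual
   [lip0 o], with [|v n (F n)| >= delta] infinitely often. Up to a small error, [v n] is
   a finite sum of molecules of total mass at most [A]; let [lambda] be a limit of the
   distributions of these masses along an ultrafilter. Smoothing [F n] at scale
   [1 / (m + 1)] with the help of a net gives a function whose local Lipschitz constant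
   is controlled by finitely many difference quotients of [F n], in a number bounded
   independently of [m]: this is the only place where the finite dimension matters.
   These difference quotients are weakly null in a space of bounded functions, hence
   tend to 0 in mean for [lambda]. So, for suitable [n_k] and [m_k], the smoothing [f_k]
   of [F n_k] at scale [1 / (m_k + 1)] has a large slope only on a set of small
   [lambda]-mass, and cutting [f_j] off, for [j > k], where [f_k] has a large slope barely
   changes [v n_j (f_j)];
   the Leibniz rule costs nothing since [f_j] is uniformly small on bounded sets. After
   these cutoffs, the sum of the slopes of the [f_k] is bounded, and such a
   series cannot be seen by a weakly null sequence (Schur's theorem).
   This follows Bourgain's treatment of spaces of smooth functions. *)

Set Implicit Arguments.
Unset Strict Implicit.
Unset Printing Implicit Defensive.

Import Order.TTheory GRing.Theory Num.Theory.
Import numFieldNormedType.Exports.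

Local Open Scope classical_set_scope.
Local Open Scope ring_scope.

(** * Limits along an ultrafilter on [nat] *)

(** The index [n_k] has to be fixed before the level [m_k]: the smoothings of [F n] converge to
    [F n] only pointwise, so how fine the level must be depends on [n]. Hence one functional must
    see all scales at once. It acts on functions of pairs (level, point) as an iterated limit, over
    [j] inside and over [m] outside; smallness of one mean then yields, for one [n], many [m] and,
    for each of them, many [j]. All choices are made in sets of one ultrafilter, which also contains
    the bad indices, so finitely many requirements can always be met together. Such a functional is
    in general only finitely additive, so a combinatorial argument on overlapping sets stands in for
    dominated convergence. This is where weak nullness in [lip0] is used in full: ultralimits of
    difference quotients along arbitrary sequences of scales and points are functionals on [lip0]
    that need not come from the free space. *)

Section ultralimit.
Context {R : realType} (U : set_system nat) {UU : UltraFilter U}.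
Implicit Types u v : nat -> R.

Definition ulim u : R := lim (u @ U).

(** A cluster point in the compact interval is a limit, since an ultrafilter contains each set or
    its complement. Without a bound [lim] may be a default value, so bounds reappear in the lemmas
    below. *)
Lemma ulim_cvg u (C : R) : (forall n, `|u n| <= C) -> u n @[n --> U] --> ulim u.
Proof.
move=> uC; suff : exists l : R, u @ U --> l by move=> /cvg_ex.
have [|p [_ clp]] := @segment_compact R (- C) C (u @ U) _.
  by apply: nearW => n; rewrite /= in_itv/= -ler_norml.
exists p => A /= Ap.
have [//|UnA] := in_ultra_setVsetC (u @^-1` A) UU.
by have [x []] := clp (~` A) A UnA Ap.
Qed.

Lemma ulimD u v (C D : R) : (forall n, `|u n| <= C) -> (forall n, `|v n| <= D) ->
  ulim (fun n => u n + v n) = ulim u + ulim v.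
Proof.
move=> uC vD; apply: cvg_lim => //.
by apply: cvgD; [exact: ulim_cvg uC|exact: ulim_cvg vD].
Qed.

Lemma ulimZ (a : R) u (C : R) : (forall n, `|u n| <= C) ->
  ulim (fun n => a * u n) = a * ulim u.
Proof. by move=> uC; apply: cvg_lim => //; apply: cvgMr; exact: ulim_cvg uC. Qed.

Lemma ler_ulim u v (C D : R) : (forall n, `|u n| <= C) -> (forall n, `|v n| <= D) ->
  (\forall n \near U, u n <= v n) -> ulim u <= ulim v.
Proof.
move=> uC vD; exact: (ler_cvg_to (ulim_cvg uC) (ulim_cvg vD)).
Qed.

Lemma ulim_norm u (C : R) : (forall n, `|u n| <= C) -> ulim (fun n => `|u n|) = `|ulim u|.
Proof. by move=> uC; apply: cvg_lim => //; apply: cvg_norm; exact: ulim_cvg uC. Qed.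

Lemma ulim_cst (c : R) : ulim (fun=> c) = c.
Proof. by apply: cvg_lim => //; exact: cvg_cst. Qed.

Lemma ulim_bound u (C : R) : (forall n, `|u n| <= C) -> `|ulim u| <= C.
Proof.
move=> uC; rewrite -(ulim_norm uC) -[leRHS]ulim_cst.
apply: (@ler_ulim _ _ C `|C|) => // [n|]; first by rewrite /= normr_id.
by apply: nearW.
Qed.

End ultralimit.

(** The tails of [P] generate a proper filter; an ultrafilter above it keeps [P] available together
    with every condition that holds eventually. *)
Lemma ultrafilter_frequently (P : set nat) : (forall N, exists2 n, (N <= n)%N & P n) ->
  exists U : set_system nat, [/\ UltraFilter U, \oo `<=` U & U P].
Proof.
move=> infP.
pose B (N : nat) : set nat := [set n | (N <= n)%N /\ P n].
have FF : ProperFilter (filter_from setT B).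
  apply: filter_from_proper => [|N _]; last by have [n Nn Pn] := infP N; exists n.
  apply: filter_from_filter; first by exists 0%N.
  move=> i j _ _; exists (maxn i j) => // n /= [].
  by rewrite geq_max => /andP[? ?] ?; split; split.
have [U [UU FU]] := ultraFilterLemma FF; exists U; split => //.
  by move=> A [N _ NA]; apply: FU; exists N => // n [Nn _]; exact: NA.
by apply: FU; exists 0%N => // n [].
Qed.

(** * Positive functionals on bounded functions *)

Definition bounded_real {R : realType} {I : Type} (f : I -> R) :=
  exists C : R, forall i, `|f i| <= C.

Section bounded_real.
Context {R : realType} {I : Type}.
Implicit Types f g : I -> R.

Lemma bounded_realD f g : bounded_real f -> bounded_real g ->
  bounded_real (fun i => f i + g i).
Proof.
move=> [C fC] [D gD]; exists (C + D) => i.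
by rewrite (le_trans (ler_normD _ _))// lerD.
Qed.

Lemma bounded_realM f g : bounded_real f -> bounded_real g ->
  bounded_real (fun i => f i * g i).
Proof.
move=> [C fC] [D gD]; exists (C * D) => i.
by rewrite normrM ler_pM.
Qed.

Lemma bounded_real_cst (c : R) : bounded_real (fun _ : I => c).
Proof. by exists `|c|. Qed.

Lemma bounded_real_indic (A : set I) : bounded_real (\1_A : I -> R).
Proof.
by exists 1 => i; rewrite indicE; case: (_ \in _); rewrite ?normr0 ?normr1.
Qed.

Lemma bounded_real_norm f : bounded_real f -> bounded_real (fun i => `|f i|).
Proof. by move=> [C fC]; exists C => i; rewrite normr_id. Qed.

Lemma bounded_real_sum (J : Type) (s : seq J) (F : J -> I -> R) :
  (forall j, bounded_real (F j)) -> bounded_real (fun i => \sum_(j <- s) F j i).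
Proof.
move=> bF; elim: s => [|j s [C sC]].
  by exists 0 => i; rewrite big_nil normr0.
have [D FD] := bF j; exists (D + C) => i.
by rewrite big_cons (le_trans (ler_normD _ _))// lerD.
Qed.

End bounded_real.

(** A finitely additive integral. The axioms concern bounded functions only, where limits along
    ultrafilters exist and are additive. *)
Structure positive_functional {R : realType} {I : Type} (L : (I -> R) -> R) : Prop := {
  positive_functionalD : forall f g, bounded_real f -> bounded_real g ->
    L (fun i => f i + g i) = L f + L g ;
  positive_functionalZ : forall (a : R) f, bounded_real f ->
    L (fun i => a * f i) = a * L f ;
  positive_functional_le : forall f g, bounded_real f -> bounded_real g ->
    (forall i, f i <= g i) -> L f <= L g }.

Section positive_functional.
Context {R : realType} {I : Type} {L : (I -> R) -> R}.
Hypothesis L_pos : positive_functional L.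

Let LD := positive_functionalD L_pos.
Let LZ := positive_functionalZ L_pos.
Let L_le := positive_functional_le L_pos.

#[local] Hint Resolve bounded_real_indic bounded_real_cst : core.

Lemma positive_functional_cst (c : R) : L (fun=> c) = c * L (fun=> 1).
Proof.
by rewrite -LZ; [congr L; apply/funext => i; rewrite mulr1|exact: bounded_real_cst].
Qed.

Lemma positive_functional_ge0 f : bounded_real f -> (forall i, 0 <= f i) -> 0 <= L f.
Proof.
move=> bf f0; rewrite -[leLHS](mul0r (L (fun=> 1))) -positive_functional_cst.
by apply: L_le => //; exact: bounded_real_cst.
Qed.

Lemma positive_functional_sum (J : Type) (s : seq J) (F : J -> I -> R) :
  (forall j, bounded_real (F j)) ->
  L (fun i => \sum_(j <- s) F j i) = \sum_(j <- s) L (F j).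
Proof.
move=> bF; elim: s => [|j s IH].
  rewrite big_nil -[RHS](mul0r (L (fun=> 1))) -positive_functional_cst.
  by congr L; apply/funext => i; rewrite big_nil.
rewrite big_cons -IH -LD//; last exact: bounded_real_sum.
by congr L; apply/funext => i; rewrite big_cons.
Qed.

Let infinite_nat (S : set nat) := forall N, exists2 n, (N <= n)%N & S n.

(* Otherwise the indicators would be almost orthogonal, and the second moment of
   a long sum of them would be too small for its mean. *)
Lemma positive_functional_overlap (B : set I) (E : nat -> set I) (S : set nat) (b : R) :
  infinite_nat S -> 0 < b -> (forall n, S n -> b <= L \1_(B `&` E n)) ->
  forall N, exists n, [/\ (N <= n)%N, S n & exists S' : set nat, exists2 b', 0 < b' &
    [/\ infinite_nat S', S' `<=` S &
        forall n', S' n' -> b' <= L \1_(B `&` E n `&` E n')]].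
Proof.
move=> infS b0 bE N; apply: contrapT => noN.
pose a := L (fun=> 1) + 1.
have a0 : 0 < a.
  by rewrite ltr_wpDl// positive_functional_ge0.
(* If all late overlaps were at most [c], a sum of [k] indicators would have second moment at most
   [k * a + k ^+ 2 * c], while Cauchy-Schwarz forces at least [(k * b) ^+ 2 / a], which is
   [2 * k ^+ 2 * c]. The [+ 1] in [a] allows division by it. *)
pose c := b ^+ 2 / (2 * a).
have c0 : 0 < c by rewrite divr_gt0// ?exprn_gt0// mulr_gt0.
have small n : (N <= n)%N -> S n -> exists M, forall n', (M <= n')%N -> S n' ->
    L \1_(B `&` E n `&` E n') <= c.
  move=> Nn Sn; apply: contrapT => noM; apply: noN; exists n; split => //.
  exists [set n' | S n' /\ c <= L \1_(B `&` E n `&` E n')], c => //.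
  split => [M||n' []//]; last by move=> n' [].
  apply: contrapT => noM'; apply: noM; exists M => n' Mn' Sn'.
  rewrite leNgt; apply/negP => cL; apply: noM'; exists n' => //; split => //.
  exact: ltW.
have ind n : bounded_real (\1_(B `&` E n) : I -> R) by exact: bounded_real_indic.
have key (k : nat) : exists2 v : I -> R, bounded_real v & exists M,
    [/\ k%:R * b <= L v, L (fun i => v i * v i) <= k%:R * a + k%:R ^+ 2 * c &
    forall n', (M <= n')%N -> S n' ->
      L (fun i => v i * \1_(B `&` E n') i) <= k%:R * c].
  elim: k => [|k [v bv [M [vb vv vM]]]].
    exists (fun=> 0) => //.
    have L0 : L (fun=> 0) = 0 by rewrite positive_functional_cst mul0r.
    exists 0%N; split.
    - by rewrite mul0r L0.
    - rewrite [X in L X](_ : _ = fun=> 0); last by apply/funext => i; rewrite mul0r.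
      by rewrite L0 mul0r add0r expr0n/= mul0r.
    - move=> n' _ _.
      rewrite [X in L X](_ : _ = fun=> 0); last by apply/funext => i; rewrite mul0r.
      by rewrite L0 mul0r.
  have [n Mn Sn] := infS (maxn N M); move: Mn; rewrite geq_max => /andP[Nn Mn].
  have [M' M'c] := small n Nn Sn.
  have bvn := bounded_realD bv (ind n).
  exists (fun i => v i + \1_(B `&` E n) i) => //.
  exists (maxn M M'); split.
  - by rewrite LD// -natr1 mulrDl mul1r lerD// bE.
  - rewrite [X in L X](_ : _ = fun i => (v i * v i + 2 * (v i * \1_(B `&` E n) i)) +
        \1_(B `&` E n) i); last first.
      apply/funext => i; rewrite indicE; case: (_ \in _) => /=; ring.
    have bM := bounded_realM bv (ind n).
    have bM2 := bounded_realM (bounded_real_cst 2) bM.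
    rewrite LD//; last exact: bounded_realD (bounded_realM bv bv) bM2.
    rewrite LD//; last exact: bounded_realM.
    rewrite LZ//.
    have L1 : L \1_(B `&` E n) <= a.
      rewrite (@le_trans _ _ (L (fun=> 1)))// ?lerDl//.
      by apply: L_le.
    have := vM n Mn Sn; rewrite -natr1.
    have k0 : 0 <= k%:R :> R by [].
    nra.
  - move=> n'; rewrite geq_max => /andP[Mn' M'n'] Sn'.
    rewrite [X in L X](_ : _ = fun i => v i * \1_(B `&` E n') i +
        \1_(B `&` E n `&` E n') i); last first.
      apply/funext => i; rewrite mulrDl; congr (_ + _).
      by rewrite -[LHS]/(((\1_(B `&` E n) : I -> R) \* \1_(B `&` E n')) i)
         -indicI setIACA setIid setIA.
    rewrite LD//; last exact: bounded_realM.
    by rewrite -natr1 mulrDl mul1r lerD// ?vM// M'c.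
pose k := (Num.truncn (2 * a ^+ 2 / b ^+ 2)).+1.
have kb : 2 * a ^+ 2 < k%:R * b ^+ 2.
  by rewrite -ltr_pdivrMr ?exprn_gt0// /k truncnS_gt.
have [v bv [M [vb vv _]]] := key k.
(* The inequality [2 * t * v - t ^+ 2 <= v * v] with the optimal [t] replaces Cauchy-Schwarz. *)
pose t := k%:R * b / a.
have : L (fun i => 2 * t * v i + - t ^+ 2) <= L (fun i => v i * v i).
  apply: L_le => [||i]; [|exact: bounded_realM|].
    by apply: bounded_realD => //; exact: bounded_realM.
  by have := sqr_ge0 (v i - t); nra.
rewrite LD//; last exact: bounded_realM.
rewrite LZ// positive_functional_cst -/a => tv.
have t0 : 0 < t by rewrite divr_gt0// mulr_gt0.
have ta : t * a = k%:R * b by rewrite /t divfK ?gt_eqF.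
have ca : c * a * 2 = b ^+ 2 by rewrite /c; field; rewrite gt_eqF.
have k0 : 0 < k%:R :> R by [].
have L1 : L (fun=> 1) <= a by rewrite lerDl.
have h1 : 2 * t * (k%:R * b) - t ^+ 2 * a <= k%:R * a + k%:R ^+ 2 * c.
  apply: le_trans vv; apply: le_trans tv; rewrite mulNr.
  apply: lerB; first by rewrite ler_pM2l// mulr_gt0.
  by rewrite ler_wpM2l// sqr_ge0.
have h2 : t ^+ 2 * a <= k%:R * a + k%:R ^+ 2 * c.
  by apply: le_trans h1; rewrite -ta; lra.
have h3 : (k%:R * b) ^+ 2 <= (k%:R * a + k%:R ^+ 2 * c) * a.
  rewrite (_ : (k%:R * b) ^+ 2 = t ^+ 2 * a * a); last by rewrite -ta; ring.
  by rewrite ler_pM2r.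
have h4 : (k%:R * b) ^+ 2 * 2 <= (k%:R * a ^+ 2) * 2 + k%:R ^+ 2 * b ^+ 2.
  rewrite (le_trans (y := (k%:R * a + k%:R ^+ 2 * c) * a * 2))// ?ler_pM2r//.
  by rewrite -ca; lra.
have h5 : k%:R * (k%:R * b ^+ 2) <= k%:R * (2 * a ^+ 2).
  by move: h4; rewrite exprMn; lra.
by move: h5; rewrite ler_pM2l// leNgt kb.
Qed.

End positive_functional.

Lemma dependent_choice (X : Type) (x0 : X) (inv : nat -> X -> Prop)
    (next : nat -> X -> X -> Prop) : inv 0%N x0 ->
  (forall k x, inv k x -> exists y, inv k.+1 y /\ next k x y) ->
  exists f : nat -> X, f 0%N = x0 /\ forall k, inv k (f k) /\ next k (f k) (f k.+1).
Proof.
move=> inv0 step.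
pose P (kx : nat * X) y := inv kx.1 kx.2 -> inv kx.1.+1 y /\ next kx.1 kx.2 y.
have [g gP] : {g & forall kx, P kx (g kx)}.
  apply: choice => -[k x]; have [kx|nkx] := pselect (inv k x).
    by have [y ?] := step _ _ kx; exists y.
  by exists x.
pose f := fix f k := if k is k'.+1 then g (k', f k') else x0.
have finv k : inv k (f k) by elim: k => // k /(gP (k, f k))[].
by exists f; split => // k; split => //; have [] := gP (k, f k) (finv k).
Qed.

Section vanishing.
Context {R : realType} {I : Type} {L : (I -> R) -> R}.
Hypothesis L_pos : positive_functional L.

(** The state consists of the intersection [B] of the chosen sets, an infinite reserve of indices
    whose sets all meet [B] in mass bounded below, and the last chosen index. The overlap lemma
    renews the reserve, so the intersections never become empty, and [p K] is a point of the one
    reached at step [K]. *)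
Lemma finite_intersection_subsequence (E : nat -> set I) (b : R) : 0 < b ->
  (forall N, exists2 n, (N <= n)%N & b <= L \1_(E n)) ->
  exists (r : nat -> nat) (p : nat -> I), (forall k, k <= r k)%N /\
    forall k K, (k <= K)%N -> E (r k) (p K).
Proof.
move=> b0 bE.
pose inv (k : nat) (s : set I * set nat * nat) :=
  (forall N, exists2 n, (N <= n)%N & s.1.2 n) /\
  exists2 b', 0 < b' & forall n, s.1.2 n -> b' <= L \1_(s.1.1 `&` E n).
pose next (k : nat) (s s' : set I * set nat * nat) :=
  [/\ (k <= s'.2)%N, s'.1.1 !=set0 & s'.1.1 = s.1.1 `&` E s'.2].
have [||f [_ fP]] := @dependent_choice _ (setT, [set n | b <= L \1_(E n)], 0%N) inv next.
- by split => //=; exists b => // n; rewrite setTI.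
- move=> k [[B S] m] [/= infS [b' b'0 b'L]].
  have [n [kn Sn [S' [c c0 [infS' S'S cL]]]]] :=
    positive_functional_overlap L_pos infS b'0 b'L k.
  exists (B `&` E n, S', n); split; first by split => //; exists c.
  split => //=; apply/set0P/eqP => BE0.
  have := b'L n Sn; rewrite BE0 indic0 leNgt.
  by rewrite [L _](positive_functional_cst L_pos) mul0r b'0.
have nonempty k : exists x, (f k.+1).1.1 x by have [_ [_ [x ?] _]] := fP k; exists x.
have [p pP] := choice nonempty.
exists (fun k => (f k.+1).2), p; split => [k|k K kK]; first by have [_ []] := fP k.
have decr j : (f (k.+1 + j)%N).1.1 `<=` E (f k.+1).2.
  elim: j => [|j IH]; first by rewrite addn0; have [_ [_ _ ->]] := fP k => x [].
  by rewrite addnS; have [_ [_ _ ->]] := fP (k.+1 + j)%N => x [/IH].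
by apply: (decr (K - k)%N); rewrite addSn subnKC.
Qed.

(* The limits along [U] over sequences of points play the role of the points of the
   Stone-Cech compactification in the usual proof by dominated convergence. *)
Lemma ultralimit_null_mean (U : set_system nat) {UU : UltraFilter U}
    (phi : nat -> I -> R) (C : R) : \oo `<=` U ->
  (forall n i, `|phi n i| <= C) ->
  (forall p : nat -> I, ulim U (fun K => phi n (p K)) @[n --> \oo] --> (0 : R)) ->
  L (fun i => `|phi n i|) @[n --> \oo] --> (0 : R).
Proof.
move=> ooU phiC phi0; apply/cvgrPdist_lt => e e0; apply: contrapT => noe.
have bphi n : bounded_real (fun i => `|phi n i|).
  by apply: bounded_real_norm; exists C.
pose a := L (fun=> 1) + 1.
have a0 : 0 < a.
  by rewrite ltr_wpDl// (positive_functional_ge0 L_pos)//; exact: bounded_real_cst.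
pose C' := `|C| + 1.
have C'0 : 0 < C' by rewrite ltr_wpDl.
pose t := e / (2 * a).
have t0 : 0 < t by rewrite divr_gt0// mulr_gt0.
pose E n := [set i | t <= `|phi n i|].
(* Chebyshev: as [t * L (fun=> 1) <= e / 2], a mean of at least [e] forces [E n] to have mass at
   least [e / (2 * C')]. *)
have [||r [p [rk pE]]] := @finite_intersection_subsequence E (e / (2 * C')).
- by rewrite divr_gt0// mulr_gt0.
- move=> N; apply: contrapT => noN; apply: noe; exists N => // n /= Nn.
  rewrite sub0r normrN ger0_norm ?(positive_functional_ge0 L_pos)//.
  rewrite ltNge; apply/negP => eL; apply: noN; exists n => //.
  rewrite ler_pdivrMr ?mulr_gt0//.
  have : L (fun i => `|phi n i|) <= L (fun i => C' * \1_(E n) i + t).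
    apply: (positive_functional_le L_pos) => // [|i].
      apply: bounded_realD; last exact: bounded_real_cst.
      by apply: bounded_realM; [exact: bounded_real_cst|exact: bounded_real_indic].
    rewrite indicE; have [iE|] := boolP (i \in _) => /=.
      rewrite mulr1 (le_trans (phiC _ _))// (le_trans (ler_norm _))//.
      by rewrite /C' -addrA lerDl addr_ge0// ltW.
    by rewrite notin_setE /E/= => /negP; rewrite -ltNge mulr0 add0r => /ltW.
  have bE : bounded_real (\1_(E n) : I -> R) by exact: bounded_real_indic.
  have bE' : bounded_real (fun i => C' * \1_(E n) i).
    by apply: bounded_realM => //; exact: bounded_real_cst.
  rewrite (positive_functionalD L_pos)//; last exact: bounded_real_cst.
  rewrite (positive_functionalZ L_pos)// (positive_functional_cst L_pos) => LE.
  have : t * L (fun=> 1) <= e / 2.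
    rewrite (@le_trans _ _ (t * a))// ?ler_pM2l ?lerDl//.
    by rewrite /t; apply: (@eq_ind_r _ _ (fun x => x <= e / 2)) => //; field; rewrite gt_eqF.
  by move: LE; rewrite -/(E n); lra.
(* At every late point of [p] the value of [|phi (r N)|] is at least [t], hence so is its
   ultralimit, although [r N >= N] is arbitrarily late. *)
have := phi0 p => /cvgrPdist_lt /(_ t t0) [N _ /(_ (r N))/=].
rewrite sub0r normrN => /(_ (rk N)); apply/negP; rewrite -leNgt.
rewrite -(ulim_norm (C := C))// -(ulim_cst (U := U) t).
apply: (@ler_ulim _ _ _ _ _ `|t| C) => // [n|]; first by rewrite normr_id.
by apply: ooU; exists N => // K /= NK; exact: pE.
Qed.

End vanishing.

(** * The Hahn--Banach theorem *)

Section hahn_banach.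
Context {R : realType} {E : lmodType R}.
Implicit Types p q : E -> R.

Definition sublinear p :=
  (forall x y, p (x + y) <= p x + p y) /\ (forall (t : R) x, 0 <= t -> p (t *: x) = t * p x).

Lemma sublinear0 p : sublinear p -> p 0 = 0.
Proof. by move=> [_ pZ]; rewrite -(scale0r 0) pZ// mul0r. Qed.

Lemma sublinear_ge p x : sublinear p -> - p (- x) <= p x.
Proof.
move=> p_sub; have [pD _] := p_sub.
by rewrite -subr_ge0 opprK addrC -(sublinear0 p_sub) -(subrr x) addrC pD.
Qed.

(* This lies below [p]; if [p] is minimal they agree, so that [p] is additive. *)
Definition sublinear_shift p (v x : E) : R :=
  inf [set p (x + t *: v) - t * p v | t in [set t | 0 <= t]].

Section shift.
Variables (p : E -> R) (v : E).
Hypothesis p_sub : sublinear p.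

Let shift_lb x : lbound [set p (x + t *: v) - t * p v | t in [set t | 0 <= t]] (- p (- x)).
Proof.
have [pD pZ] := p_sub.
move=> _ [t /= t0 <-]; rewrite lerBrDr addrC lerBlDr -pZ//.
by rewrite -[X in p X <= _](addKr x (t *: v)) addrC pD.
Qed.

Lemma sublinear_shift_le x (t : R) : 0 <= t ->
  sublinear_shift p v x <= p (x + t *: v) - t * p v.
Proof. by move=> t0; apply: ge_inf; [exists (- p (- x)); exact: shift_lb|exists t]. Qed.

Lemma sublinear_shift_le_self x : sublinear_shift p v x <= p x.
Proof. by have := @sublinear_shift_le x 0 (lexx _); rewrite scale0r addr0 mul0r subr0. Qed.

Let shift_ge x c : (forall t : R, 0 <= t -> c <= p (x + t *: v) - t * p v) ->
  c <= sublinear_shift p v x.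
Proof.
move=> cp; apply: lb_le_inf; first by exists (p (x + 0 *: v) - 0 * p v), 0 => /=.
by move=> _ [t /= t0 <-]; exact: cp.
Qed.

Lemma sublinear_shift_sublinear : sublinear (sublinear_shift p v).
Proof.
have [pD pZ] := p_sub; split=> [x y|t x].
  rewrite -lerBlDr; apply: shift_ge => s s0.
  rewrite lerBlDr -lerBlDl; apply: shift_ge => t t0.
  rewrite lerBlDr.
  rewrite (le_trans (sublinear_shift_le (x + y) (addr_ge0 s0 t0)))//.
  have := pD (x + s *: v) (y + t *: v).
  by rewrite addrACA -scalerDl mulrDl; lra.
rewrite le_eqVlt => /predU1P[<-|t0].
  rewrite scale0r mul0r; apply/eqP; rewrite eq_le; apply/andP; split.
    by rewrite -(sublinear0 p_sub); exact: sublinear_shift_le_self.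
  by apply: shift_ge => s s0; rewrite add0r pZ// subrr.
have leZ (s : R) z : 0 < s -> sublinear_shift p v (s *: z) <= s * sublinear_shift p v z.
  move=> s0; rewrite -ler_pdivrMl//; apply: shift_ge => r r0.
  rewrite ler_pdivrMl// (le_trans (sublinear_shift_le _ (mulr_ge0 (ltW s0) r0)))//.
  by rewrite -scalerA -scalerDr pZ ?(ltW s0)// -mulrA -mulrBr.
apply/eqP; rewrite eq_le leZ//= -ler_pdivlMl//.
have := leZ t^-1 (t *: x); rewrite invr_gt0 scalerA mulVf ?gt_eqF// scale1r.
exact.
Qed.

Lemma sublinear_shiftN : sublinear_shift p v (- v) <= - p v.
Proof.
have := @sublinear_shift_le (- v) 1 ler01.
by rewrite scale1r addNr (sublinear0 p_sub) mul1r sub0r.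
Qed.

End shift.

(** Zorn's lemma, with [below] reversing the pointwise order. The infimum of a chain stays
    subadditive because, of two members, the smaller one serves both arguments; it is finite thanks
    to the lower bound [- p (- x)]. *)
Lemma sublinear_minimal p : sublinear p -> exists q : E -> R,
  [/\ sublinear q, forall x, q x <= p x &
      forall q', sublinear q' -> (forall x, q' x <= q x) -> q' = q].
Proof.
move=> p_sub.
pose Q := {q : E -> R | sublinear q /\ forall x, q x <= p x}.
pose below (q q' : {classic Q}) := `[< forall x, sval q' x <= sval q x >].
have Qp : sublinear p /\ forall x, p x <= p x by [].
suff [[q [q_sub qp]] qmin] : exists q : {classic Q}, premaximal below q.
  exists q; split => // q' q'_sub q'q.
  have Qq' : sublinear q' /\ forall x, q' x <= p x.
    by split => // x; rewrite (le_trans (q'q x)).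
  have /asboolP/= qq' := qmin (exist _ q' Qq') (introT (asboolP _) q'q).
  by apply/funext => x; apply/eqP; rewrite eq_le q'q qq'.
apply: (ZL_preorder (exist _ p Qp : {classic Q})).
- by move=> q; exact/asboolP.
- move=> q q' q'' /asboolP qq' /asboolP q'q''; apply/asboolP => x.
  exact: le_trans (q'q'' x) (qq' x).
move=> A Atot; have [[q0 Aq0]|A0] := pselect (A !=set0); last first.
  by exists (exist _ p Qp) => q Aq; exfalso; apply: A0; exists q.
pose m x := inf [set sval q x | q in A].
have lbm x : has_lbound [set sval q x | q in A].
  exists (- p (- x)) => _ [q Aq <-] /=; have [q_sub qp] := svalP q.
  by rewrite (le_trans _ (sublinear_ge x q_sub))// lerN2.
have m_le (q : {classic Q}) x : A q -> m x <= sval q x by move=> Aq; apply: ge_inf => //; exists q.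
have le_m c x : (forall q : {classic Q}, A q -> c <= sval q x) -> c <= m x.
  move=> cA; apply: lb_le_inf; first by exists (sval q0 x), q0.
  by move=> _ [q Aq <-]; exact: cA.
have m_sub : sublinear m.
  split=> [x y|t x t0].
    rewrite -lerBlDr; apply: (le_m) => q Aq; rewrite lerBlDr -lerBlDl.
    apply: (le_m) => q' Aq'; rewrite lerBlDr.
    have [/asboolP qq'|/asboolP q'q] := (Atot _ _ Aq Aq').
      rewrite (le_trans (m_le q' _ Aq'))// (le_trans ((svalP q').1.1 _ _))//.
      by rewrite addrC lerD.
    rewrite (le_trans (m_le q _ Aq))// (le_trans ((svalP q).1.1 _ _))//.
    by rewrite addrC lerD.
  apply/eqP; rewrite eq_le; apply/andP; split; last first.
    apply: (le_m) => q Aq; rewrite (svalP q).1.2//.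
    by rewrite ler_wpM2l// m_le.
  move: t0; rewrite [0 <= t]le_eqVlt => /predU1P[<-|t0].
    rewrite mul0r scale0r (le_trans (m_le _ _ Aq0))//.
    by rewrite (sublinear0 (svalP q0).1).
  rewrite -ler_pdivrMl//; apply: (le_m) => q Aq.
  by rewrite ler_pdivrMl// -(svalP q).1.2 ?(ltW t0)// m_le.
have mp x : m x <= p x by rewrite (le_trans (m_le _ _ Aq0))//; exact: (svalP q0).2.
exists (exist _ m (conj m_sub mp)) => q Aq; apply/asboolP => x /=.
exact: m_le.
Qed.

(** A minimal sublinear functional equals all of its shifts and is therefore additive. Starting from
    the shift of [p] at [v], and not from [p] itself, gives [l (- v) <= - p v], hence equality at
    [v]. *)
Theorem hahn_banach_sublinear p v : sublinear p -> exists l : {linear E -> R^o},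
  (forall x, l x <= p x) /\ l v = p v.
Proof.
move=> p_sub.
have [q [q_sub qp qmin]] := sublinear_minimal (sublinear_shift_sublinear v p_sub).
have qS w : sublinear_shift q w = q.
  apply: qmin; first exact: sublinear_shift_sublinear.
  exact: sublinear_shift_le_self.
have qD x y : q (x + y) = q x + q y.
  apply/eqP; rewrite eq_le q_sub.1/=.
  have := @sublinear_shift_le q y q_sub x 1 ler01.
  by rewrite qS scale1r mul1r; lra.
have qN x : q (- x) = - q x.
  by apply/eqP; rewrite -addr_eq0 -qD addNr (sublinear0 q_sub).
have q_lin : linear (q : E -> R^o).
  move=> a x y; rewrite qD; congr (_ + _).
  have [a0|a0] := leP 0 a; first exact: q_sub.2.
  by rewrite -[LHS]opprK -qN -scaleNr q_sub.2 ?oppr_ge0 ?ltW// mulNr opprK.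
pose l : {linear E -> R^o} := HB.pack (q : E -> R^o) (GRing.isLinear.Build R E R^o *:%R q q_lin).
exists l; split=> [x|]; first exact: le_trans (qp x) (sublinear_shift_le_self _ p_sub _).
apply/eqP; rewrite eq_le (le_trans (qp v) (sublinear_shift_le_self _ p_sub _))//=.
by rewrite -lerN2 -[X in X <= _]qN (le_trans (qp _))// sublinear_shiftN.
Qed.

End hahn_banach.

(** * Molecules in the Lipschitz-free space *)

Lemma dual_sumE {R : realType} {V : normedModType R} (I : Type) (s : seq I)
    (f : I -> dual_space V) (x : V) :
  (\sum_(i <- s) f i) x = \sum_(i <- s) f i x.
Proof.
by elim: s => [|i s IH]; rewrite ?big_nil// !big_cons -IH.
Qed.

Section lip0_facts.
Context {R : realType} {T : metricType R} {o : T}.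

Lemma lip0_in (f : T -> R) (k : R) : lipschitz_const f k -> f o = 0 ->
  (f : T -> R^o) \in lip0_pred o.
Proof. by move=> fk fo; rewrite inE; split => //; exists k. Qed.

Lemma lip0_norm_bound (f : lip0 o) (k : R) : 0 <= k ->
  (forall x y, `|f x - f y| <= k * mdist x y) -> `|f| <= k.
Proof. by move=> k0 fk; apply: lip0_norm_le. Qed.

Lemma lip0_le (f : lip0 o) x y : `|f x - f y| <= `|f| * mdist x y.
Proof. exact: (lip0_norm_const f).2. Qed.

Lemma dual_le {V : normedModType R} (v : dual_space V) (f : V) : `|v f| <= `|v| * `|f|.
Proof. exact: le_dual_norm. Qed.

Lemma free_pred_approx (v : dual_space (lip0 o)) (e : R) : v \in @free_pred R T o -> 0 < e ->
  exists n (c : 'I_n -> R) (x : 'I_n -> T),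
    `|v - \sum_(i < n) c i *: evaluation o (x i)| < e.
Proof.
move=> /free_predP vo /vo[w [n [c [a [aT ->]]]] vw].
have /choice[x xP] i : exists x, evaluation o x = a i.
  by have [x _ <-] := aT i; exists x.
by exists n, c, x; under eq_bigr do rewrite xP.
Qed.

(* Kantorovich duality: Hahn--Banach for the gauge that measures the molecules
   [delta_x - delta_y] by [mdist x y] and everything else by [K] times the norm. *)
Lemma free_molecules (v : dual_space (lip0 o)) (eps : R) : v \in @free_pred R T o -> 0 < eps ->
  exists s : seq (R * (T * T)),
    \sum_(e <- s) `|e.1| * mdist e.2.1 e.2.2 <= `|v| + 1 /\
    forall f : lip0 o, `|v f - \sum_(e <- s) e.1 * (f e.2.1 - f e.2.2)| <= eps * `|f|.
Proof.
move=> vo eps0.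
pose mol (e : R * (T * T)) := e.1 *: (evaluation o e.2.1 - evaluation o e.2.2).
have nv1 : 0 < `|v| + 1 by rewrite ltr_wpDl.
(* With this [K], a decomposition of cost less than [|v| + 1] has a remainder of norm at most
   [eps]. *)
pose K := (`|v| + 1) / eps.
have K0 : 0 < K by rewrite divr_gt0.
pose A (u : dual_space (lip0 o)) : set R := [set c | exists s r,
  u = \sum_(e <- s) mol e + r /\ c = \sum_(e <- s) `|e.1| * mdist e.2.1 e.2.2 + K * `|r| ].
pose p u := inf (A u).
have cost_ge0 (s : seq (R * (T * T))) : 0 <= \sum_(e <- s) `|e.1| * mdist e.2.1 e.2.2.
  by apply: sumr_ge0 => e _; rewrite mulr_ge0// mdist_ge0.
have A0 u : A u !=set0.
  by exists (K * `|u|), [::], u; rewrite !big_nil !add0r.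
have lbA u : has_lbound (A u).
  by exists 0 => _ [s [r [_ ->]]]; rewrite addr_ge0// mulr_ge0// ltW.
have p_le u s r : u = \sum_(e <- s) mol e + r ->
    p u <= \sum_(e <- s) `|e.1| * mdist e.2.1 e.2.2 + K * `|r|.
  by move=> us; apply: ge_inf => //; exists s, r.
have le_p c u : (forall s r, u = \sum_(e <- s) mol e + r ->
    c <= \sum_(e <- s) `|e.1| * mdist e.2.1 e.2.2 + K * `|r|) -> c <= p u.
  by move=> cA; apply: lb_le_inf => // _ [s [r [us ->]]]; exact: cA.
have p_leK u : p u <= K * `|u|.
  by rewrite (le_trans (p_le u [::] u _))// big_nil add0r.
have p_ge0 u : 0 <= p u.
  by apply: (le_p) => s r _; rewrite addr_ge0// mulr_ge0// ltW.
have pZ t u : 0 < t -> p (t *: u) <= t * p u.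
  move=> t0; rewrite -ler_pdivrMl//; apply: (le_p) => s r us.
  rewrite ler_pdivrMl//.
  rewrite (le_trans (p_le _ [seq (t * e.1, e.2) | e <- s] (t *: r) _))//.
    rewrite us scalerDr scaler_sumr big_map; congr (_ + _).
    by apply: eq_bigr => e _; rewrite /mol scalerA.
  rewrite big_map mulrDr mulr_sumr normrZ gtr0_norm// mulrCA lerD2r.
  by apply: ler_sum => e _ /=; rewrite normrM gtr0_norm// mulrA.
have p_sub : sublinear p.
  split=> [x y|t x].
    rewrite -lerBlDr; apply: (le_p) => s r xs; rewrite lerBlDr -lerBlDl.
    apply: (le_p) => s' r' ys; rewrite lerBlDl.
    rewrite (le_trans (p_le _ (s ++ s') (r + r') _))//.
      by rewrite xs ys big_cat/= addrACA.
    rewrite big_cat/= addrACA lerD2l -mulrDr ler_pM2l// ler_normD//.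
  rewrite le_eqVlt => /predU1P[<-|t0].
    rewrite mul0r scale0r; apply/eqP; rewrite eq_le p_ge0 andbT.
    by rewrite (le_trans (p_leK _))// normr0 mulr0.
  apply/eqP; rewrite eq_le pZ//= -ler_pdivlMl//.
  have := pZ t^-1 (t *: x); rewrite invr_gt0 scalerA mulVf ?gt_eqF// scale1r.
  exact.
have [l [lp lv]] := hahn_banach_sublinear v p_sub.
have lK u : `|l u| <= K * `|u|.
  rewrite ler_norml -lerNl (le_trans (lp u))// andbT.
  by rewrite -linearN (le_trans (lp _))// (le_trans (p_leK _))// normrN.
(* On molecules [p] is at most the distance, so [l] induces a function [F] in the unit ball of
   [lip0]. Since [l] is norm continuous and [v] lies in the closed span of the evaluations,
   [l v = v F], whence [p v <= |v|]. *)
pose f x : R := l (evaluation o x).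
have fL x y : f x - f y <= mdist x y.
  rewrite -linearB (le_trans (lp _))// (le_trans (p_le _ [:: (1, (x, y))] 0 _))//.
    by rewrite big_seq1 addr0 /mol scale1r.
  by rewrite big_seq1/= normr0 mulr0 addr0 normr1 mul1r.
have fk : lipschitz_const (f : T -> R^o) 1.
  split => // x y; rewrite mul1r ler_norml fL andbT lerNl opprB metric_sym fL//.
have fo : f o = 0.
  rewrite /f (_ : evaluation o o = 0) ?linear0//.
  by apply: dualP => g; exact: lip0_base.
pose F := Lip0 (lip0_in fk fo).
have F1 : `|F| <= 1 by apply: lip0_norm_bound => //; exact: fk.2.
have lvF : l v = v F.
  apply/eqP; rewrite -subr_eq0 -normr_le0; apply/ler_addgt0Pl => e e0.
  have d0 : 0 < e / (K + 1) by rewrite divr_gt0// addr_gt0.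
  have [n [c [x xv]]] := free_pred_approx vo d0.
  set w := \sum_(i < n) _ in xv.
  have lw : l w = w F.
    rewrite /w linear_sum dual_sumE; apply: eq_bigr => i _.
    by rewrite linearZ.
  rewrite (_ : l v - v F = l (v - w) - (v - w) F); last first.
    rewrite linearB -[(v - w) F]/(v F - w F) lw.
    by rewrite opprB addrA subrK.
  rewrite addr0 (le_trans (ler_normB _ _))//.
  rewrite (le_trans (lerD (lK _) (dual_le _ _)))//.
  rewrite (@le_trans _ _ ((K + 1) * `|v - w|))//.
    by rewrite mulrDl mul1r lerD2l ler_piMr.
  by rewrite mulrC -ler_pdivlMr ?addr_gt0// ltW.
have pv : p v < `|v| + 1.
  rewrite -lv lvF (le_lt_trans (ler_norm _))// (le_lt_trans (dual_le _ _))//.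
  by rewrite (@le_lt_trans _ _ `|v|)// ?ler_piMr// ltrDl.
have [_ [s [r [vs ->]]] sr] : exists2 c, A v c & c < `|v| + 1 by exact: inf_lt.
exists s; split=> [|g].
  by rewrite (le_trans _ (ltW sr))// lerDl mulr_ge0// ltW.
have -> : v g - \sum_(e <- s) e.1 * (g e.2.1 - g e.2.2) = r g.
  rewrite [in v g]vs -[(_ + r) g]/((\sum_(e <- s) mol e) g + r g) dual_sumE.
  by rewrite addrC addrA (_ : - _ + _ = 0) ?add0r// addNr.
rewrite (le_trans (dual_le _ _))// ler_wpM2r//.
have : K * `|r| <= `|v| + 1 by rewrite (le_trans _ (ltW sr))// lerDr.
by rewrite /K mulrAC ler_pdivrMr// ler_pM2l.
Qed.

End lip0_facts.

(** * Duality between the Lipschitz-free space and [lip0] *)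

Section dual_facts.
Context {R : realType}.

Lemma bounded_in_dual {V : normedModType R} (l : V -> R^o) (C : R) : linear l ->
  (forall x, `|l x| <= C * `|x|) -> l \in @dual_pred R V.
Proof.
move=> l_lin lC; rewrite inE; split => //.
pose l' : {linear V -> R^o} := HB.pack l (GRing.isLinear.Build R V R^o *:%R _ l_lin).
apply: (@bounded_linear_continuous _ _ _ l'); apply/linear_boundedP.
near=> r => x; rewrite (le_trans (lC x))// ler_wpM2r//.
Unshelve. all: by end_near. Qed.

Lemma dualZ {V : normedModType R} (f : dual_space V) (a : R) x : f (a *: x) = a * f x.
Proof. by rewrite -[a *: x]addr0 dual_linear linear0 addr0. Qed.

Lemma dualB {V : normedModType R} (f : dual_space V) x y : f (x - y) = f x - f y.
Proof. exact: linearB. Qed.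

Lemma dual_bidual_in {V : normedModType R} (x : V) :
  (fun f : dual_space V => f x : R^o) \in @dual_pred R (dual_space V).
Proof. by apply: (@bounded_in_dual _ _ `|x|) => // f; rewrite mulrC dual_le. Qed.

Definition bidual {V : normedModType R} (x : V) : dual_space (dual_space V) :=
  DualSpace (dual_bidual_in x).

Lemma pointwise_null_bounded {V : completeNormedModType R} (f : nat -> dual_space V) :
  (forall x, f n x @[n --> \oo] --> (0 : R)) -> exists C : R, forall n, `|f n| <= C.
Proof.
move=> f0.
have [|x|C FC] := @Banach_Steinhauss R V R^o [set g | exists n, g = dual_val (f n)] _ _ 1.
- move=> _ [n ->]; split; last exact: dual_linear.
  move=> r; exists (`|f n| * `|r|) => x xr.
  by rewrite (le_trans (dual_le _ _))// ler_wpM2l// (le_trans xr)// ler_norm.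
- have /cvg_seq_bounded/pinfty_ex_gt0[M M0 fM] : cvgn (fun n => f n x : R^o).
    by apply/cvg_ex; exists 0; exact: f0.
  by exists M => _ [n ->]; exact: fM.
exists C => n; apply: ge_sup; first exact: (dual_has_sup _).1.
by move=> _ [x /= x1 <-]; apply: FC => //; exists n.
Qed.

Context {T : metricType R} {o : T}.

Lemma evaluation_free (x : T) : evaluation o x \in @free_pred R T o.
Proof.
rewrite inE; apply: subset_closure.
by exists 1%N, (fun=> 1), (fun=> evaluation o x); split => //; rewrite big_ord1 scale1r.
Qed.

Definition delta (x : T) : free_space o := FreeSpace (evaluation_free x).

Lemma delta_base : delta o = 0.
Proof. by apply: val_inj; apply: dualP => f; exact: lip0_base. Qed.

Lemma evaluation_le x y : `|evaluation o x - evaluation o y| <= mdist x y.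
Proof.
apply: dual_norm_le => [|f]; first exact: mdist_ge0.
by rewrite mulrC; exact: lip0_le.
Qed.

Lemma delta_lipschitz (f : dual_space (free_space o)) :
  lipschitz_const (fun x => f (delta x) : R^o) `|f|.
Proof.
split=> // x y; rewrite -linearB (le_trans (dual_le _ _))// ler_wpM2l//.
exact: evaluation_le.
Qed.

Definition restrict (f : dual_space (free_space o)) : lip0 o :=
  Lip0 (lip0_in (delta_lipschitz f) (etrans (congr1 f delta_base) (linear0 f))).

Lemma restrict_le f : `|restrict f| <= `|f|.
Proof. by apply: lip0_norm_le; exact: delta_lipschitz. Qed.

Lemma free_val_sum (I : Type) (s : seq I) (v : I -> free_space o) :
  free_val (\sum_(i <- s) v i) = \sum_(i <- s) free_val (v i).
Proof.
by elim: s => [|i s IH]; rewrite ?big_nil// !big_cons -IH.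
Qed.

(** Both sides are continuous in [v] and agree on the dense span of the [delta x]. *)
Lemma restrictE (f : dual_space (free_space o)) (v : free_space o) : f v = free_val v (restrict f).
Proof.
apply/eqP; rewrite -subr_eq0 -normr_le0; apply/ler_addgt0Pl => e e0; rewrite addr0.
have d0 : 0 < e / (2 * `|f| + 1) by rewrite divr_gt0// ltr_wpDl.
have [n [c [x]]] := free_pred_approx (free_valP v) d0.
pose w : free_space o := \sum_(i < n) c i *: delta (x i).
have -> : \sum_(i < n) c i *: evaluation o (x i) = free_val w.
  by rewrite free_val_sum.
move=> vw.
have fw : f w = free_val w (restrict f).
  rewrite (raddf_sum f) free_val_sum dual_sumE.
  by apply: eq_bigr => i _; rewrite -[LHS]/(f (c i *: delta (x i))) dualZ.
rewrite (_ : f v - _ = f (v - w) - free_val (v - w) (restrict f)); last first.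
  rewrite dualB -[free_val (v - w) _]/(free_val v (restrict f) - free_val w (restrict f)).
  by rewrite fw opprB addrA subrK.
rewrite (le_trans (ler_normB _ _))// (le_trans (lerD (dual_le _ _) (dual_le _ _)))//.
rewrite (@le_trans _ _ ((2 * `|f| + 1) * `|free_val v - free_val w|))//; last first.
  by rewrite mulrC -ler_pdivlMr ?ltr_wpDl// ltW.
rewrite -[`|v - w|]/(`|free_val v - free_val w|).
rewrite -[free_val (v - w)]/(free_val v - free_val w).
have := restrict_le f; have : 0 <= `|free_val v - free_val w| by [].
set a := `|_ - _|; nra.
Qed.

Lemma lip0_functional_in (g : lip0 o) :
  (fun v : free_space o => free_val v g : R^o) \in @dual_pred R (free_space o).
Proof.
by apply: (@bounded_in_dual _ _ `|g|) => // v; rewrite mulrC; exact: dual_le.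
Qed.

Definition lip0_functional (g : lip0 o) : dual_space (free_space o) :=
  DualSpace (lip0_functional_in g).

Lemma lip0_functional_le g : `|lip0_functional g| <= `|g|.
Proof.
apply: dual_norm_le => [|v]; first exact: normr_ge0.
rewrite mulrC; exact: (dual_le (free_val v) g).
Qed.

Lemma weakly_null_free (x : nat -> free_space o) : weakly_null x ->
  (forall g, free_val (x n) g @[n --> \oo] --> (0 : R)) /\
  exists C : R, forall n, `|free_val (x n)| <= C.
Proof.
move=> x0; split=> [g|]; first exact: (x0 (lip0_functional g)).
have [C xC] := @pointwise_null_bounded (dual_space (free_space o)) (fun n => bidual (x n)) x0.
exists C => n; apply: dual_norm_le => [|g]; first exact: le_trans (xC n).
rewrite -[_ g]/(bidual (x n) (lip0_functional g)) (le_trans (dual_le _ _))//.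
by rewrite ler_pM// lip0_functional_le.
Qed.

(** Composing with [restrict] turns every functional on [lip0] into one on the dual of the free
    space, so weak convergence is inherited in full, and not just pointwise convergence. *)
Lemma weakly_null_restrict (f : nat -> dual_space (free_space o)) : weakly_null f ->
  weakly_null (fun n => restrict (f n)) /\ exists C : R, forall n, `|restrict (f n)| <= C.
Proof.
move=> f0; split=> [q|].
  have qr : (fun g => q (restrict g) : R^o) \in @dual_pred R (dual_space (free_space o)).
    apply: (@bounded_in_dual _ _ `|q|) => [a g h|g].
      rewrite -linearP; congr (q _); exact: val_inj.
    by rewrite (le_trans (dual_le _ _))// ler_wpM2l// restrict_le.
  exact: (f0 (DualSpace qr)).
have [|C fC] := @pointwise_null_bounded (free_space o) f; first by move=> x; exact: (f0 (bidual x)).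
by exists C => n; rewrite (le_trans (restrict_le _)).
Qed.

(** On bounded sets an element of the free space is uniformly close to a finite combination of
    evaluations. A general element of the dual of [lip0] lacks this weak-star continuity. *)
Lemma free_bounded_cvg (v : dual_space (lip0 o)) (u : nat -> lip0 o) (w : lip0 o) (C : R) :
  v \in @free_pred R T o -> (forall n, `|u n| <= C) ->
  (forall x, u n x @[n --> \oo] --> (w x : R)) -> v (u n) @[n --> \oo] --> (v w : R).
Proof.
move=> vo uC uw; apply/cvgrPdist_lt => e e0.
have C1 : 0 < `|C| + `|w| + 1 by rewrite ltr_wpDl// addr_ge0.
have d0 : 0 < e / 2 / (`|C| + `|w| + 1) by rewrite !divr_gt0.
have [n [c [x]]] := free_pred_approx vo d0; set a := \sum_(i < n) _ => va.
have /cvgrPdist_lt/(_ (e / 2))[|N _ Na] : a (u k) @[k --> \oo] --> (a w : R).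
- rewrite /a dual_sumE (_ : (fun k => _) = fun k => \sum_(i < n) c i * u k (x i)).
    by apply: cvg_big => [|i _]; [exact: add_continuous|apply: cvgMr; exact: uw].
  by apply/funext => k; rewrite dual_sumE.
- by rewrite divr_gt0.
exists N => // k Nk; rewrite /= -dualB.
rewrite -[v _](subrK (a (w - u k))) (le_lt_trans (ler_normD _ _))// [ltRHS]splitr.
rewrite ler_ltD//; last by rewrite dualB; exact: Na.
rewrite -[leLHS]/(`|(v - a) (w - u k)|) (le_trans (dual_le _ _))//.
rewrite (@le_trans _ _ (`|v - a| * (`|C| + `|w| + 1)))//; last first.
  by rewrite -ler_pdivlMr// ltW.
rewrite ler_wpM2l// (le_trans (ler_normB _ _))// addrC -addrA lerD//.
  by rewrite (le_trans (uC k))// ler_norm.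
by rewrite lerDl.
Qed.

End dual_facts.

(** * Weakly unconditionally Cauchy series in [lip0] *)

Section schur.
Context {R : realType} {T : metricType R} {o : T}.

Lemma sum_subsequence_le (u : nat -> R) (r : nat -> nat) K : (forall k, 0 <= u k) ->
  {homo r : i j / (i < j)%N} -> \sum_(k < K) u (r k) <= \sum_(k < r K) u k.
Proof.
move=> u0 rmono; elim: K => [|K IH].
  by rewrite big_ord0 sumr_ge0.
rewrite big_ord_recr/= (@le_trans _ _ (\sum_(k < (r K).+1) u k))//.
  by rewrite big_ord_recr/= lerD2r.
rewrite -!(big_mkord xpredT) (big_cat_nat _ (rmono _ _ (ltnSn K)))//= lerDl.
by rewrite sumr_ge0.
Qed.

Lemma geometric_sum_le K : \sum_(k < K) (2^-1 : R) ^+ k <= 2.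
Proof.
suff -> : \sum_(k < K) (2^-1 : R) ^+ k = 2 - 2 * 2^-1 ^+ K.
  by rewrite gerBl mulr_ge0// exprn_ge0// invr_ge0.
elim: K => [|K IH]; first by rewrite big_ord0 expr0; lra.
by rewrite big_ord_recr/= IH exprS; lra.
Qed.

Section limit.
Variables (g : nat -> lip0 o) (C : R).
Hypothesis g_sum : forall K x y, \sum_(k < K) `|g k x - g k y| <= C * mdist x y.

Let g_summable x y : cvgn (series (fun k => `|g k x - g k y|)).
Proof.
apply: nondecreasing_is_cvgn.
  by apply: nondecreasing_series => n _ _.
exists (C * mdist x y) => _ [K _ <-]; rewrite /series/= big_mkord.
exact: g_sum.
Qed.

Lemma summable_lip0_null x : g k x @[k --> \oo] --> (0 : R).
Proof.
apply/norm_cvg0P; have := cvg_series_cvg_0 (@g_summable x o).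
by under eq_fun do rewrite lip0_base subr0.
Qed.

Lemma summable_lip0_sum : exists G : lip0 o, forall x,
  \sum_(k < K) g k x @[K --> \oo] --> (G x : R).
Proof.
have cg x : cvgn (series (fun k => g k x : R)).
  apply: normed_cvg; rewrite /normed_series_of/=.
  have := @g_summable x o; rewrite /series/=.
  by under eq_fun do under eq_bigr do rewrite lip0_base subr0.
pose G x := limn (series (fun k => g k x : R)).
have Gcvg x : \sum_(k < K) g k x @[K --> \oo] --> (G x : R).
  have := cg x; rewrite /G /series/=.
  by under eq_fun do rewrite big_mkord.
have Gk : lipschitz_const (G : T -> R^o) `|C|.
  split => // x y.
  have : `|\sum_(k < K) g k x - \sum_(k < K) g k y| @[K --> \oo] --> (`|G x - G y| : R).
    by apply: cvg_norm; apply: cvgB; exact: Gcvg.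
  move/(cvgr_to_le); apply.
  apply: nearW => K; rewrite -sumrB (le_trans (ler_norm_sum _ _ _))//.
  by rewrite (le_trans (g_sum _ _ _))// ler_wpM2r ?mdist_ge0// ler_norm.
have Go : G o = 0.
  have := Gcvg o; under eq_fun do under eq_bigr do rewrite lip0_base.
  under eq_fun do rewrite big1_eq.
  by move/cvg_lim => <-//; rewrite lim_cst.
by exists (Lip0 (lip0_in Gk Go)).
Qed.

End limit.

Lemma lip0_sumE (I : Type) (s : seq I) (f : I -> lip0 o) (x : T) :
  (\sum_(i <- s) f i) x = \sum_(i <- s) f i x.
Proof.
by elim: s => [|i s IH]; rewrite ?big_nil// !big_cons -IH.
Qed.

(* Schur's gliding hump for the operator [v |-> (v (g k))_k] into l^1. *)
Lemma weakly_unconditionally_cauchy_null (g : nat -> lip0 o) (C delta : R)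
    (v : nat -> dual_space (lip0 o)) : 0 < delta ->
  (forall K x y, \sum_(k < K) `|g k x - g k y| <= C * mdist x y) ->
  (forall n, v n \in @free_pred R T o) ->
  (forall f, v n f @[n --> \oo] --> (0 : R)) ->
  ~ (forall k, delta <= `|v k (g k)|).
Proof.
move=> delta0 g_sum vo v0 vg.
have gC k : `|g k| <= `|C|.
  apply: lip0_norm_bound => // x y.
  rewrite (@le_trans _ _ (C * mdist x y))//; last by rewrite ler_wpM2r ?mdist_ge0// ler_norm.
  by rewrite (le_trans _ (g_sum k.+1 x y))// big_ord_recr/= lerDr sumr_ge0.
have g0 n : v n (g k) @[k --> \oo] --> (0 : R).
  rewrite -(linear0 (v n)); apply: (free_bounded_cvg (vo n) gC) => x.
  exact: summable_lip0_null g_sum x.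
(* In [small] below, the term of index [l] may be controlled only by [eps l.-1], which turns 16 into
   8; the off-diagonal terms then add up to at most [delta / 4]. *)
pose eps k : R := delta / 16 * 2^-1 ^+ k.
have eps0 k : 0 < eps k by rewrite mulr_gt0 ?divr_gt0// exprn_gt0// invr_gt0.
have thr j : exists N, (j < N)%N /\ forall n k, (N <= n)%N -> (k <= j)%N ->
    `|v n (g k)| <= eps j /\ `|v k (g n)| <= eps j.
  suff [N _ NP] : \forall n \near \oo, forall k : 'I_j.+1,
      `|v n (g k)| <= eps j /\ `|v k (g n)| <= eps j.
    exists (maxn N j.+1); split=> [|n k]; first by rewrite leq_max ltnSn orbT.
    by rewrite geq_max => /andP[Nn _] kj; exact: (NP n Nn (Ordinal (kj : k < j.+1)%N)).
  apply: filter_forall => k; near=> n; split.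
    by near: n; have /cvgr0_norm_le/(_ _ (eps0 j)) := v0 (g k).
  by near: n; have /cvgr0_norm_le/(_ _ (eps0 j)) := g0 k.
have [N NP] := choice thr.
pose r := fix r k := if k is k'.+1 then N (r k') else 0%N.
have r_lt k : (r k < r k.+1)%N by have [] := NP (r k).
have r_mono : {homo r : i j / (i < j)%N} by apply: homo_ltn => //; exact: ltn_trans.
have r_mono' : {homo r : i j / (i <= j)%N}.
  by apply: homo_leq => // [|i]; [exact: leq_trans|exact: ltnW].
have r_ge k : (k <= r k)%N by elim: k => // k IH; exact: leq_ltn_trans (r_lt k).
have [G GP] : exists G : lip0 o, forall x, \sum_(k < K) g (r k) x @[K --> \oo] --> (G x : R).
  apply: (@summable_lip0_sum (g \o r) C) => K x y.
  by rewrite (le_trans (sum_subsequence_le (u := fun k => `|g k x - g k y|) _ _ r_mono)).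
have eps_anti i j : (i <= j)%N -> eps j <= eps i.
  by move=> ij; rewrite /eps ler_pM2l ?divr_gt0// ler_wiXn2l// ?invr_ge0// invf_le1// ler1n.
have small i l : l != i -> `|v (r i) (g (r l))| <= delta / 8 * 2^-1 ^+ l.
  have epsl j : (l <= j.+1)%N -> eps j <= delta / 8 * 2^-1 ^+ l.
    case: l => [|l] lj.
      rewrite (le_trans (eps_anti 0%N j _))// /eps expr0.
      by rewrite ler_pM2r//; lra.
    by rewrite (le_trans (eps_anti l j _))// /eps exprS; have := eps0 l; rewrite /eps; lra.
  have below a b : (a < b)%N ->
      `|v (r b) (g (r a))| <= eps b.-1 /\ `|v (r a) (g (r b))| <= eps b.-1.
    case: b => // b ab.
    have [_ /(_ (r b.+1) (r a) (leqnn _) (@r_mono' a b ab))[h1 h2]] := NP (r b).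
    by split; [apply: le_trans h1 _|apply: le_trans h2 _]; rewrite eps_anti ?r_ge.
  rewrite neq_ltn => /orP[li|il].
    by rewrite (le_trans (below _ _ li).1)// epsl// prednK ?(ltnW li)// (leq_ltn_trans _ li).
  by rewrite (le_trans (below _ _ il).2)// epsl// prednK// (leq_ltn_trans _ il).
have vG i : delta / 2 <= `|v (r i) G|.
  have cv : v (r i) (\sum_(k < K) g (r k)) @[K --> \oo] --> (v (r i) G : R).
    apply: (@free_bounded_cvg _ _ _ _ _ _ `|C|) => // [K|x].
      apply: lip0_norm_bound => // x y; rewrite !lip0_sumE -sumrB.
      rewrite (le_trans (ler_norm_sum _ _ _))//.
      rewrite (le_trans (sum_subsequence_le (u := fun k => `|g k x - g k y|) _ _ r_mono))//.
      by rewrite (le_trans (g_sum _ _ _))// ler_wpM2r ?mdist_ge0// ler_norm.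
    by under eq_fun do rewrite lip0_sumE; exact: GP.
  move/cvg_norm in cv; apply: (cvgr_to_ge cv).
  exists i.+1 => // K /= iK.
  rewrite (raddf_sum (v (r i))) (bigD1 (Ordinal iK))//=.
  rewrite (le_trans _ (lerB_normD _ _))//.
  have := vg (r i).
  have : `|\sum_(l < K | l != Ordinal iK) v (r i) (g (r l))| <= delta / 4.
    rewrite (le_trans (ler_norm_sum _ _ _))//.
    rewrite (@le_trans _ _ (\sum_(l < K) delta / 8 * 2^-1 ^+ l))//.
      rewrite [leRHS](bigID (fun l : 'I_K => l != Ordinal iK))/= -[leLHS]addr0 lerD//.
        by apply: ler_sum => l li; exact: small.
      by rewrite sumr_ge0// => l _; rewrite mulr_ge0 ?exprn_ge0 ?invr_ge0// ltW// divr_gt0.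
    by rewrite -mulr_sumr; have := geometric_sum_le K; nra.
  by rewrite /=; lra.
have /cvgr0_norm_lt/(_ (delta / 2))[|M _ MP] := v0 G; first by rewrite divr_gt0.
by have := MP (r M) (r_ge M); rewrite ltNge vG.
Unshelve. all: by end_near. Qed.

End schur.

(** * Smoothing along nets *)

Section plateau.
Context {R : realType} {T : metricType R}.
Implicit Types (x y p : T).

Definition lip (k : R) (f : T -> R) := forall x y, `|f x - f y| <= k * mdist x y.

(** The Leibniz rule, arranged so that the factor of [|a - a'|] is the smaller of the two values of
    [f]: it is enough that [f] is small at one of the points. *)
Lemma normB_mul_le (a a' f f' : R) : 0 <= a -> 0 <= a' ->
  `|a * f - a' * f'| <= Num.max a a' * `|f - f'| + Num.min `|f| `|f'| * `|a - a'|.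
Proof.
move=> a0 a'0; have [ff'|f'f] := leP `|f| `|f'|.
  rewrite (_ : a * f - a' * f' = a' * (f - f') + f * (a - a')); last by ring.
  rewrite (le_trans (ler_normD _ _))// !normrM lerD2r (ger0_norm a'0) ler_wpM2r//.
  by rewrite le_max lexx orbT.
rewrite (_ : a * f - a' * f' = a * (f - f') + f' * (a - a')); last by ring.
rewrite (le_trans (ler_normD _ _))// !normrM lerD2r (ger0_norm a0) ler_wpM2r//.
by rewrite le_max lexx.
Qed.

Definition plateau (a h : R) p x : R := Num.min 1 (Num.max 0 (a - mdist p x / h)).

Lemma plateau_ge0 a h p x : 0 <= plateau a h p x.
Proof. by rewrite /plateau le_min ler01 le_max lexx. Qed.

Lemma plateau_le1 a h p x : plateau a h p x <= 1.
Proof. by rewrite /plateau ge_min lexx. Qed.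

Lemma plateau_eq1 a h p x : 0 < h -> mdist p x <= (a - 1) * h -> plateau a h p x = 1.
Proof.
move=> h0 px; rewrite /plateau; apply/min_idPl; rewrite le_max; apply/orP; right.
by rewrite lerBrDr addrC -lerBrDr ler_pdivrMr.
Qed.

Lemma plateau_eq0 a h p x : 0 < h -> a * h <= mdist p x -> plateau a h p x = 0.
Proof.
move=> h0 px; rewrite /plateau max_l; first by apply/min_idPr.
by rewrite subr_le0 ler_pdivlMr.
Qed.

Lemma mdistB_le p x y : `|mdist p x - mdist p y| <= mdist x y.
Proof.
have := metric_triangle p x y; have := metric_triangle p y x.
by rewrite (metric_sym y x) ler_norml; lra.
Qed.

Lemma plateau_lip a h p : 0 < h -> lip h^-1 (plateau a h p).
Proof.
move=> h0 x y; rewrite /plateau.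
have : `|(a - mdist p x / h) - (a - mdist p y / h)| <= h^-1 * mdist x y.
  rewrite (_ : _ - _ = h^-1 * (mdist p y - mdist p x)); last by ring.
  rewrite normrM ger0_norm ?invr_ge0 ?(ltW h0)// ler_wpM2l ?invr_ge0 ?(ltW h0)//.
  by rewrite distrC mdistB_le.
apply: le_trans; move: (a - _) (a - _) => u v.
by case: (leP 0 u) => hu; case: (leP 0 v) => hv; [case: (leP 1 u); case: (leP 1 v)|
  case: (leP 1 u); case: (leP 1 0)|case: (leP 1 0); case: (leP 1 v)|case: (leP 1 0)] => *;
  rewrite ler_norml; have := ler_norm (u - v); have := ler_norm (v - u);
  rewrite (distrC v); lra.
Qed.

End plateau.

Section smoothing.
Context {R : realType} {T : metricType R} (o : T).
Variables (h rho : R) (s : seq T) (q : nat).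

Definition truncation (F : T -> R) x := plateau 2 rho o x * F x.

Definition net_weight x := \sum_(p <- s) plateau 3 h p x.

(** The maximum with 1 keeps the denominator away from 0 outside the region covered by the net;
    inside, the weight is at least 1 and the coefficients form a partition of unity. *)
Definition net_coef p x := plateau 3 h p x / Num.max 1 (net_weight x).

Definition net_average F x := \sum_(p <- s) net_coef p x * truncation F p.

Definition smoothing F x := net_average F x - net_average F o.

(* Up to a constant, this bounds the local Lipschitz constant of [smoothing F] at [x]: the
   weights are 1 at distance [4 * h], while only points of the net at distance less than
   [3 * h] contribute to the average at a point at distance less than [h] from [x]. *)
Definition net_slope F x := \sum_(p <- s) \sum_(p' <- s)
  plateau 5 h p x * plateau 5 h p' x * (`|truncation F p - truncation F p'| / h).

Definition near_net x := [seq p <- s | mdist p x < 5 * h].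

(** The default [x] of [nth] keeps both points within [5 * h] of [x] for all indices. The points do
    not depend on [F], so the quotient is linear in [F]. *)
Definition net_quotient x (i j : nat) (F : T -> R) :=
  (truncation F (nth x (near_net x) i) - truncation F (nth x (near_net x) j)) / h.

Hypotheses (h0 : 0 < h) (h1 : h <= 1) (rho0 : 0 < rho).
Hypothesis s_cover : forall x, mdist o x <= 2 * rho + 10 ->
  exists2 p, p \in s & mdist p x <= h.
Hypothesis s_count : forall x, (size (near_net x) <= q)%N.

Ltac net_lra := have := h0; have := h1; have := rho0; lra.

Lemma net_sum_le (u : T -> R) (c : R) x : 0 <= c ->
  (forall p, mdist p x < 5 * h -> u p <= c) -> (forall p, 5 * h <= mdist p x -> u p = 0) ->
  \sum_(p <- s) u p <= q%:R * c.
Proof.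
move=> c0 uc u0.
rewrite (bigID (fun p => mdist p x < 5 * h))/= [X in _ + X]big1 ?addr0; last first.
  by move=> p; rewrite -leNgt => /u0.
rewrite -big_filter -/(near_net x) (@le_trans _ _ (\sum_(p <- near_net x) c))//.
  rewrite big_seq [leRHS]big_seq; apply: ler_sum => p.
  by rewrite mem_filter => /andP[px _]; exact: uc.
rewrite big_const_seq count_predT iter_addr_0 -[leLHS]mulr_natl ler_wpM2r//.
by rewrite ler_nat.
Qed.

Lemma net_weight_ge1 x : mdist o x <= 2 * rho + 10 -> 1 <= net_weight x.
Proof.
move=> /s_cover[p ps px]; rewrite /net_weight (big_rem p)//= plateau_eq1//; last first.
  by rewrite (le_trans px)// ler_peMl//; [exact: ltW|net_lra].
by rewrite lerDl sumr_ge0// => p' _; exact: plateau_ge0.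
Qed.

Lemma net_coef_ge0 p x : 0 <= net_coef p x.
Proof. by rewrite divr_ge0 ?plateau_ge0// le_max ler01. Qed.

Lemma net_coef_eq0 p x : 3 * h <= mdist p x -> net_coef p x = 0.
Proof. by move=> px; rewrite /net_coef plateau_eq0// mul0r. Qed.

Lemma sum_net_coef x : mdist o x <= 2 * rho + 10 -> \sum_(p <- s) net_coef p x = 1.
Proof.
move=> /net_weight_ge1 x1; rewrite -mulr_suml (max_idPr x1) divff//.
by rewrite gt_eqF// (lt_le_trans _ x1).
Qed.

(** The numerator contributes 1 and the normalization [q]: at most [q] weights change between two
    points at distance less than [h]. *)
Lemma net_coef_lip p x y : mdist x y < h ->
  `|net_coef p x - net_coef p y| <= (1 + q%:R) * (h^-1 * mdist x y).
Proof.
move=> xyh; rewrite /net_coef.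
pose D z := Num.max 1 (net_weight z).
have D1 z : 1 <= D z by rewrite le_max lexx.
have D0 z : 0 < D z by rewrite (lt_le_trans _ (D1 z)).
have V0 z : 0 <= (D z)^-1 by rewrite invr_ge0 (ltW (D0 z)).
have V1 z : (D z)^-1 <= 1 by rewrite invf_le1 ?D1 ?D0.
rewrite -!/(D _).
have DD : `|(D x)^-1 - (D y)^-1| <= q%:R * (h^-1 * mdist x y).
  rewrite (_ : (D x)^-1 - (D y)^-1 = (D y - D x) * ((D x)^-1 * (D y)^-1)); last first.
    by field; rewrite !gt_eqF.
  rewrite normrM (@le_trans _ _ `|D y - D x|)//.
    by rewrite ler_piMr// ger0_norm ?mulr_ge0// mulr_ile1.
  rewrite (@le_trans _ _ `|net_weight x - net_weight y|)//.
    rewrite distrC /D; move: (net_weight x) (net_weight y) => u v.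
    case: (leP 1 u) => hu; case: (leP 1 v) => hv; rewrite ler_norml;
    have := ler_norm (u - v); have := ler_norm (v - u); rewrite (distrC v); lra.
  rewrite -sumrB (le_trans (ler_norm_sum _ _ _))//; apply: (@net_sum_le _ _ x).
  - by rewrite mulr_ge0 ?invr_ge0 ?mdist_ge0// ltW.
  - by move=> p' _; exact: plateau_lip.
  - move=> p' xp'; have := metric_triangle p' y x; rewrite (metric_sym y x) => tri.
    by rewrite !plateau_eq0 ?subrr ?normr0//; net_lra.
have := @normB_mul_le R (plateau 3 h p x) (plateau 3 h p y) (D x)^-1 (D y)^-1
  (plateau_ge0 _ _ _ _) (plateau_ge0 _ _ _ _).
move=> /le_trans; apply; rewrite mulrDl mul1r addrC lerD//.
  rewrite -[leRHS]mul1r ler_pM//; last exact: plateau_lip.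
  by rewrite ge_min ger0_norm ?V0// V1.
rewrite (le_trans _ DD)// ler_piMl// ge_max !plateau_le1//.
Qed.

Variables (B : R) (F : T -> R).
Hypotheses (FB : lip B F) (B0 : 0 <= B) (Fo : F o = 0).

Let G := truncation F.

Ltac net_nra := have := h0; have := B0; nra.

Lemma truncation_eq0 x : 2 * rho <= mdist o x -> G x = 0.
Proof. by move=> ox; rewrite /G /truncation plateau_eq0// mul0r. Qed.

Lemma truncation_id x : mdist o x <= rho -> G x = F x.
Proof. by move=> ox; rewrite /G /truncation plateau_eq1 ?mul1r//; net_lra. Qed.

Lemma truncation_lip : lip (3 * B) G.
Proof.
move=> x y; rewrite /G /truncation.
have xy0 := mdist_ge0 x y.
rewrite (le_trans (normB_mul_le _ _ (plateau_ge0 _ _ _ _) (plateau_ge0 _ _ _ _)))//.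
have -> : 3 * B * mdist x y = B * mdist x y + (B * (2 * rho)) * (rho^-1 * mdist x y).
  by field; rewrite gt_eqF.
have F_le z : `|F z| <= B * mdist o z.
  by have := FB z o; rewrite Fo subr0 metric_sym.
rewrite lerD//.
  rewrite -[leRHS]mul1r ler_pM//; first by rewrite le_max plateau_ge0.
  by rewrite ge_max !plateau_le1.
(* If the cutoffs differ, one of the points lies in the ball of radius [2 * rho], where
   [|F| <= 2 * rho * B]; against the slope [rho^-1] of the cutoff this gives the extra [2 * B]. *)
have [->|ne] := eqVneq (plateau 2 rho o x) (plateau 2 rho o y).
  rewrite subrr normr0 mulr0 !mulr_ge0 ?invr_ge0//; exact: ltW.
rewrite ler_pM ?plateau_lip ?le_min ?normr_ge0//.
have [xr|xr] := leP (2 * rho) (mdist o x); last first.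
  by rewrite ge_min (le_trans (F_le x)) ?ler_wpM2l// ltW.
have [yr|yr] := leP (2 * rho) (mdist o y); last first.
  by rewrite ge_min orbC (le_trans (F_le y)) ?ler_wpM2l// ltW.
by move: ne; rewrite !plateau_eq0// eqxx.
Qed.

Lemma net_average_eq0 x : 2 * rho + 5 <= mdist o x -> net_average F x = 0.
Proof.
move=> ox; apply: big1 => p _.
have [xp|xp] := leP (3 * h) (mdist p x); first by rewrite net_coef_eq0 ?mul0r.
rewrite -/G truncation_eq0 ?mulr0//.
by have := metric_triangle o p x; net_lra.
Qed.

Lemma net_average_near x : `|net_average F x - G x| <= 9 * h * B.
Proof.
have [ox|ox] := leP (mdist o x) (2 * rho + 10); last first.
  rewrite net_average_eq0 ?truncation_eq0 ?subr0 ?normr0; [|net_lra|net_lra].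
  by rewrite !mulr_ge0// ltW.
rewrite -[G x]mul1r -[X in X * G x](sum_net_coef ox) mulr_suml -sumrB.
rewrite (le_trans (ler_norm_sum _ _ _))//.
rewrite -[leRHS]mul1r -[X in _ <= X * _](sum_net_coef ox) mulr_suml.
apply: ler_sum => p _; rewrite -mulrBr normrM ger0_norm ?net_coef_ge0//.
have [xp|xp] := leP (3 * h) (mdist p x); first by rewrite net_coef_eq0 ?mul0r.
rewrite ler_wpM2l ?net_coef_ge0// (le_trans (truncation_lip _ _))//.
rewrite (_ : 9 * h * B = 3 * B * (3 * h)); last by ring.
by rewrite ler_wpM2l ?mulr_ge0// ltW.
Qed.

Lemma net_slope_ge0 x : 0 <= net_slope F x.
Proof.
apply: sumr_ge0 => p _; apply: sumr_ge0 => p' _.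
by rewrite !mulr_ge0 ?plateau_ge0// invr_ge0 ltW.
Qed.

Lemma net_slope_eq0 x : 2 * rho + 9 <= mdist o x -> net_slope F x = 0.
Proof.
move=> ox; apply: big1 => p _; apply: big1 => p' _.
have G0 z : mdist z x < 5 * h -> truncation F z = 0.
  by move=> zx; rewrite -/G truncation_eq0//; have := metric_triangle o z x; net_lra.
have [px|px] := leP (5 * h) (mdist p x); first by rewrite plateau_eq0// !mul0r.
have [p'x|p'x] := leP (5 * h) (mdist p' x); last first.
  by rewrite !G0// subrr normr0 mul0r mulr0.
by rewrite [plateau _ _ p' _]plateau_eq0// mulr0 mul0r.
Qed.

(** The coefficients sum to 1 at [x] and at [y], so the constant [G p0], for a net point [p0] within
    [h] of [x], may be subtracted. The coefficients that still vary belong to points within [4 * h]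
    of [x], where the plateaus of [net_slope] equal 1. *)
Lemma net_average_local x y : mdist x y < h ->
  `|net_average F x - net_average F y| <= (1 + q%:R) * net_slope F x * mdist x y.
Proof.
move=> xy.
have xy0 := mdist_ge0 x y.
have q1 : 0 <= 1 + q%:R :> R by rewrite addr_ge0.
have tri := metric_triangle o x y; have tri' := metric_triangle o y x.
rewrite (metric_sym y x) in tri'.
have [ox|ox] := leP (mdist o x) (2 * rho + 9); last first.
  rewrite !net_average_eq0 ?subrr ?normr0; [|net_lra|net_lra].
  by rewrite !mulr_ge0 ?net_slope_ge0.
have ox' : mdist o x <= 2 * rho + 10 by net_lra.
have oy' : mdist o y <= 2 * rho + 10 by net_lra.
have [p0 p0s p0x] := s_cover ox'.
rewrite (_ : net_average F x - net_average F y =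
  \sum_(p <- s) (net_coef p x - net_coef p y) * (G p - G p0)); last first.
  have avg z : mdist o z <= 2 * rho + 10 ->
      \sum_(p <- s) net_coef p z * (G p - G p0) = net_average F z - G p0.
    move=> oz; under eq_bigr do rewrite mulrBr.
    by rewrite sumrB -mulr_suml sum_net_coef// mul1r.
  under [RHS]eq_bigr do rewrite mulrBl.
  by rewrite sumrB !avg// opprB addrA subrK.
rewrite (le_trans (ler_norm_sum _ _ _))//.
rewrite (_ : _ * _ * _ = \sum_(p <- s) (1 + q%:R) * mdist x y *
  \sum_(p' <- s) plateau 5 h p x * plateau 5 h p' x * (`|G p - G p'| / h)); last first.
  by rewrite -mulr_sumr -/(net_slope F x); ring.
apply: ler_sum => p _.
rewrite (@le_trans _ _ ((1 + q%:R) * mdist x y *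
  (plateau 5 h p x * (`|G p - G p0| / h))))//; last first.
  rewrite ler_wpM2l ?mulr_ge0// (big_rem p0)//= [plateau 5 h p0 x]plateau_eq1 ?mulr1; last 2 first.
  - exact: h0.
  - by net_lra.
  by rewrite lerDl sumr_ge0// => p' _; rewrite !mulr_ge0 ?plateau_ge0// invr_ge0 ltW.
rewrite normrM; have [px|px] := leP (4 * h) (mdist p x).
  rewrite !net_coef_eq0 ?subrr ?normr0 ?mul0r; last 2 first.
  - by have := metric_triangle p y x; rewrite (metric_sym y x); net_lra.
  - by net_lra.
  by rewrite !mulr_ge0 ?plateau_ge0// invr_ge0 ltW.
rewrite plateau_eq1 ?mul1r//; last by net_lra.
rewrite [leRHS](_ : _ = (1 + q%:R) * (h^-1 * mdist x y) * `|G p - G p0|); last by ring.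
by rewrite ler_wpM2r// net_coef_lip.
Qed.

(** Padding the near points to exactly [q] indices makes the number of terms independent of [h] and
    [x]; each term is the absolute value of a linear functional of [F]. *)
Lemma net_slope_le_quotients x :
  net_slope F x <= \sum_(i < q) \sum_(j < q) `|net_quotient x i j F|.
Proof.
have near_sum (u : T -> R) : (forall p, 0 <= u p) -> (forall p, 5 * h <= mdist p x -> u p = 0) ->
    \sum_(p <- s) u p <= \sum_(i < q) u (nth x (near_net x) i).
  move=> u0 ufar.
  rewrite (bigID (fun p => mdist p x < 5 * h))/= [X in _ + X]big1 ?addr0; last first.
    by move=> p; rewrite -leNgt => /ufar.
  rewrite -big_filter -/(near_net x) (big_nth x) big_mkord.
  rewrite (big_ord_widen _ (fun i => u (nth x (near_net x) i)) (s_count x)).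
  rewrite [leRHS](bigID (fun i : 'I_q => (i < size (near_net x))%N))/= lerDl.
  exact: sumr_ge0.
have term0 p p' :
    0 <= plateau 5 h p x * plateau 5 h p' x * (`|truncation F p - truncation F p'| / h).
  by rewrite !mulr_ge0 ?plateau_ge0// invr_ge0 ltW.
rewrite /net_slope (le_trans (near_sum _ _ _))//.
- by move=> p; exact: sumr_ge0.
- by move=> p px; apply: big1 => p' _; rewrite plateau_eq0// !mul0r.
apply: ler_sum => i _; rewrite (le_trans (near_sum _ _ _))//.
- by move=> p px; rewrite [plateau 5 h p x]plateau_eq0// mulr0 mul0r.
apply: ler_sum => j _; rewrite /net_quotient normrM [`|h^-1|]ger0_norm ?invr_ge0 ?(ltW h0)//.
rewrite ler_piMl//; first by rewrite !mulr_ge0// invr_ge0 ltW.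
by rewrite mulr_ile1 ?plateau_ge0 ?plateau_le1.
Qed.

Lemma net_quotient_le x i j : `|net_quotient x i j F| <= 30 * B.
Proof.
rewrite /net_quotient normrM [`|h^-1|]ger0_norm ?invr_ge0 ?(ltW h0)//.
rewrite ler_pdivrMr// (le_trans (truncation_lip _ _))//.
have near k : mdist (nth x (near_net x) k) x <= 5 * h.
  have [kn|kn] := ltnP k (size (near_net x)); last first.
    by rewrite nth_default// mdistxx mulr_ge0// ltW.
  by have := mem_nth x kn; rewrite mem_filter => /andP[/ltW].
set a := nth _ _ i; set b := nth _ _ j.
have := metric_triangle a x b; have := near i; have := near j.
rewrite -/a -/b (metric_sym b x); net_nra.
Qed.

Lemma net_slope_le x : net_slope F x <= q%:R ^+ 2 * (30 * B).
Proof.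
rewrite (le_trans (net_slope_le_quotients x))//.
rewrite (@le_trans _ _ (\sum_(i < q) \sum_(j < q) (30 * B)))//.
  by apply: ler_sum => i _; apply: ler_sum => j _; exact: net_quotient_le.
have sum_cst (c : R) : \sum_(i < q) c = q%:R * c.
  by rewrite sumr_const card_ord mulr_natl.
by rewrite !sum_cst expr2 mulrA.
Qed.

(** The constant may depend on the net. It makes the cutoffs Lipschitz, and the next function is
    taken small enough to compensate for it. *)
Lemma net_slope_lip : exists2 L, 0 <= L & lip L (net_slope F).
Proof.
rewrite /net_slope.
have lip_sum (I : Type) (t : seq I) (f : I -> T -> R) :
    (forall i, exists2 L, 0 <= L & lip L (f i)) ->
    exists2 L, 0 <= L & lip L (fun x => \sum_(i <- t) f i x).
  move=> fL; elim: t => [|i t [L L0 tL]].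
    by exists 0 => // x y; rewrite !big_nil subrr normr0 mul0r.
  have [M M0 iM] := fL i; exists (M + L) => [|x y]; first exact: addr_ge0.
  rewrite !big_cons opprD addrACA mulrDl (le_trans (ler_normD _ _))//.
  by rewrite lerD.
apply: (lip_sum) => p; apply: lip_sum => p'.
have hV : 0 <= h^-1 by rewrite invr_ge0 ltW.
set c := _ / h; have c0 : 0 <= c by rewrite mulr_ge0.
exists (2 * h^-1 * c) => [|x y]; first by rewrite !mulr_ge0.
rewrite -mulrBl normrM [`|c|]ger0_norm// mulrAC ler_wpM2r//.
rewrite (le_trans (normB_mul_le _ _ (plateau_ge0 _ _ _ _) (plateau_ge0 _ _ _ _)))//.
have -> : 2 * h^-1 * mdist x y = 1 * (h^-1 * mdist x y) + 1 * (h^-1 * mdist x y).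
  by ring.
rewrite lerD// ler_pM ?plateau_lip//.
- by rewrite le_max plateau_ge0.
- by rewrite ge_max !plateau_le1.
- by rewrite ge_min ger0_norm ?plateau_ge0// plateau_le1.
Qed.

(* Pairs of points at distance at least [h] contribute [21], the other ones the rest. *)
Definition smoothing_const := 21 + 30 * (1 + q%:R) * q%:R ^+ 2 : R.

Lemma net_average_lip : lip (smoothing_const * B) (net_average F).
Proof.
move=> x y; have xy0 := mdist_ge0 x y.
have q0 : 0 <= q%:R :> R by [].
have q2 : 0 <= q%:R ^+ 2 :> R by rewrite sqr_ge0.
have [hxy|xyh] := leP h (mdist x y).
  have -> : net_average F x - net_average F y = (net_average F x - G x) -
      (net_average F y - G y) + (G x - G y) by ring.
  rewrite (le_trans (ler_normD _ _))// (le_trans (lerD (ler_normB _ _) (lexx _)))//.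
  have := net_average_near x; have := net_average_near y; have := truncation_lip x y.
  have : B * h <= B * mdist x y by rewrite ler_wpM2l.
  have : 0 <= 30 * (1 + q%:R) * q%:R ^+ 2 * (B * mdist x y).
    by rewrite !mulr_ge0// addr_ge0.
  by rewrite /smoothing_const; net_lra.
rewrite (le_trans (net_average_local xyh))// ler_wpM2r//.
have := net_slope_le x; have := net_slope_ge0 x.
have : 0 <= 1 + q%:R :> R by rewrite addr_ge0.
by rewrite /smoothing_const; net_nra.
Qed.

Lemma smoothing_near x : mdist o x <= rho -> `|smoothing F x - F x| <= 18 * h * B.
Proof.
move=> ox; rewrite -truncation_id// /smoothing.
have := net_average_near x; have := net_average_near o.
rewrite [G o](_ : _ = 0) ?subr0; last by rewrite /G /truncation Fo mulr0.
rewrite addrAC => h2 h3; rewrite (le_trans (ler_normB _ _))//; net_lra.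
Qed.

End smoothing.

(** * Disjointification of gradients *)

(* At each point [x] at most one of the [f k] with slope above [2^-k] at [x] survives
   multiplication by [pi k]; the cutoffs cost little because [f k] is small where
   [pi k] varies. Pairs of points too far apart for the local slope to be relevant
   are harmless except for at most one scale [h] and one radius [rho]. *)
Lemma cutoff_products_summable {R : realType} {T : metricType R} (o : T)
    (f V pi : nat -> T -> R) (h rho : nat -> R) (A : R) :
  (forall x, pi 0%N x = 1) ->
  (forall k x, pi k.+1 x = pi k x * (1 - Num.min 1 (2 ^+ k * V k x))) ->
  (forall k x, 0 <= V k x <= A) -> (forall k, lip A (f k)) ->
  (forall k x y, mdist x y < h k.+1 -> `|f k x - f k y| <= V k x * mdist x y) ->
  (forall k, h k.+1 <= h k) -> (forall k, rho k <= rho k.+1) ->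
  (forall k x, mdist o x < rho k -> `|f k x| <= 2^-1 ^+ k * h k) ->
  (forall k x, rho k <= mdist o x -> pi k x = 1) ->
  (forall k x y, mdist o x < rho k ->
    `|f k x| * `|pi k x - pi k y| <= 2^-1 ^+ k * mdist x y) ->
  (forall k x y, rho k.+1 <= mdist o x -> `|f k x - f k y| <= 2^-1 ^+ k * mdist x y) ->
  forall K x y, \sum_(k < K) `|pi k x * f k x - pi k y * f k y| <=
    (10 + 4 * A) * mdist x y.
Proof.
move=> pi0 piS VA fA f_loc h_anti rho_mono f_small pi1 pi_lip f_far K x y.
have A0 : 0 <= A by have /andP[/le_trans] := VA 0%N x; apply.
have e0 k : 0 < 2^-1 ^+ k :> R by rewrite exprn_gt0// invr_gt0.
have pi01 k z : 0 <= pi k z <= 1.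
  elim: k => [|k /andP[IH0 IH1]]; first by rewrite pi0 ler01 lexx.
  have m0 : 0 <= Num.min 1 (2 ^+ k * V k z).
    by rewrite le_min ler01 mulr_ge0 ?exprn_ge0//; case/andP: (VA k z).
  have m1 : Num.min 1 (2 ^+ k * V k z) <= 1 by rewrite ge_min lexx.
  by rewrite piS mulr_ge0 ?subr_ge0//= mulr_ile1 ?subr_ge0// gerBl.
(* Each term is at most [2^-1 ^+ k + A * (pi k z - pi k.+1 z)], which telescopes: either [V k z] is
   at most [2^-1 ^+ k], or [pi k.+1 z] is 0. *)
have slope_sum z : \sum_(k < K) pi k z * V k z <= 2 + A.
  rewrite (@le_trans _ _ (\sum_(k < K) (2^-1 : R) ^+ k + A * (1 - pi K z)))//; last first.
    have /andP[p0 _] := pi01 K z; have := geometric_sum_le (R := R) K.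
    by have := mulr_ge0 A0 p0; lra.
  elim: K => [|k IH]; first by rewrite !big_ord0 pi0 subrr mulr0 addr0.
  rewrite !big_ord_recr/= piS.
  have /andP[p0 p1] := pi01 k z; have /andP[V0 V1] := VA k z; have ek := e0 k.
  have p2 : 2^-1 ^+ k * 2 ^+ k = 1 :> R by rewrite -exprMn mulVf// expr1n.
  have [le1|gt1] := leP 1 (2 ^+ k * V k z).
    by have := ler_wpM2l p0 V1; rewrite subrr mulr0; lra.
  have Ve : V k z <= 2^-1 ^+ k.
    have q0 : 0 < 2 ^+ k :> R by rewrite exprn_gt0.
    by rewrite -(ler_pM2l q0) [leRHS]mulrC p2 ltW.
  have V20 : 0 <= 2 ^+ k * V k z by rewrite mulr_ge0// exprn_ge0.
  have : pi k z * V k z <= 2^-1 ^+ k by rewrite -[leRHS]mul1r ler_pM.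
  have : 0 <= A * (pi k z * (2 ^+ k * V k z)) by rewrite !mulr_ge0// exprn_ge0.
  by rewrite mulrBr mulr1; lra.
set d := mdist x y; have d0 : 0 <= d by exact: mdist_ge0.
pose t := Num.max (mdist o x) (mdist o y).
(* Both are nondecreasing in [k] with values 0 and 1, so their increments sum to at most 1; these
   pay for the scale with [h k.+1 <= d < h k] and for the radius with [rho k <= t < rho k.+1]. *)
pose u k : R := (h k <= d)%R%:R; pose w k : R := (t < rho k)%R%:R.
have term (k : nat) : `|pi k x * f k x - pi k y * f k y| <= d * (3 * 2^-1 ^+ k +
    (pi k x * V k x + pi k y * V k y) + A * (u k.+1 - u k) + A * (w k.+1 - w k)).
  have /andP[px0 px1] := pi01 k x; have /andP[py0 py1] := pi01 k y.
  have /andP[Vx0 _] := VA k x; have /andP[Vy0 _] := VA k y.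
  have ek := ltW (e0 k).
  have cutoff : Num.min `|f k x| `|f k y| * `|pi k x - pi k y| <= d * 2^-1 ^+ k.
    rewrite [leRHS]mulrC /d; have [xr|xr] := ltP (mdist o x) (rho k).
      by rewrite (le_trans _ (pi_lip _ _ y xr))// ler_wpM2r// ge_min lexx.
    have [yr|yr] := ltP (mdist o y) (rho k).
      rewrite (metric_sym x y) (le_trans _ (pi_lip _ _ x yr))//.
      by rewrite (distrC (pi k y)) ler_wpM2r// ge_min lexx orbT.
    by rewrite !pi1// subrr normr0 mulr0 mulr_ge0 ?mdist_ge0.
  rewrite (le_trans (normB_mul_le _ _ px0 py0))// -/d.
  suff main : Num.max (pi k x) (pi k y) * `|f k x - f k y| <= d * (2 * 2^-1 ^+ k +
      (pi k x * V k x + pi k y * V k y) + A * (u k.+1 - u k) + A * (w k.+1 - w k)).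
    by move: main cutoff; lra.
  have max1 : Num.max (pi k x) (pi k y) <= 1 by rewrite ge_max px1.
  have max0 : 0 <= Num.max (pi k x) (pi k y) by rewrite le_max px0.
  have bound c : `|f k x - f k y| <= c -> Num.max (pi k x) (pi k y) * `|f k x - f k y| <= c.
    by apply: le_trans; rewrite ler_piMl.
  have Vpi : 0 <= pi k x * V k x + pi k y * V k y by rewrite addr_ge0// mulr_ge0.
  have wmono : 0 <= A * (w k.+1 - w k).
    rewrite mulr_ge0// subr_ge0 /w ler_nat; case: (ltP t (rho k)) => // tk.
    by rewrite (lt_le_trans tk).
  have umono : 0 <= A * (u k.+1 - u k).
    rewrite mulr_ge0// subr_ge0 /u ler_nat; case: (leP (h k) d) => // hd.
    by rewrite (le_trans _ hd).
  have [dh|hd] := ltP d (h k.+1).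
    have fx := f_loc k x y dh.
    have fy : `|f k x - f k y| <= V k y * d.
      by rewrite distrC /d metric_sym f_loc// metric_sym.
    have : Num.max (pi k x) (pi k y) * `|f k x - f k y| <=
        d * (pi k x * V k x + pi k y * V k y).
      rewrite /Num.max; case: ifP => _; rewrite -/d in fx.
        rewrite (le_trans (ler_wpM2l py0 fy))//.
        have : 0 <= d * (pi k x * V k x) by rewrite !mulr_ge0.
        lra.
      rewrite (le_trans (ler_wpM2l px0 fx))//.
      have : 0 <= d * (pi k y * V k y) by rewrite !mulr_ge0.
      lra.
    have : 0 <= d * (2^-1 ^+ k) by rewrite mulr_ge0.
    have := mulr_ge0 d0 umono; have := mulr_ge0 d0 wmono; lra.
  apply: bound.
  have dVpi := mulr_ge0 d0 Vpi; have du := mulr_ge0 d0 umono.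
  have dw := mulr_ge0 d0 wmono; have de := mulr_ge0 d0 ek.
  have [dhk|hdk] := ltP d (h k).
    have u1 : u k.+1 - u k = 1 by rewrite /u hd leNgt dhk subr0.
    by have := fA k x y; rewrite u1 -/d; lra.
  have [tr|rt] := ltP t (rho k).
    have : `|f k x - f k y| <= 2 * 2^-1 ^+ k * d.
      rewrite (le_trans (ler_normB _ _))// (@le_trans _ _ (2 * (2^-1 ^+ k * h k)))//.
        move: tr; rewrite gt_max => /andP[xr yr].
        by have := f_small k x xr; have := f_small k y yr; lra.
      by rewrite -mulrA ler_pM2l// ler_wpM2l.
    by lra.
  have [tr'|rt'] := ltP t (rho k.+1).
    have w1 : w k.+1 - w k = 1 by rewrite /w tr' ltNge rt subr0.
    by have := fA k x y; rewrite w1 -/d; lra.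
  have : `|f k x - f k y| <= 2^-1 ^+ k * d.
    move: rt'; rewrite le_max => /orP[xr|yr]; first exact: f_far.
    by rewrite distrC /d metric_sym f_far.
  by lra.
rewrite (@le_trans _ _ (\sum_(k < K) d * (3 * 2^-1 ^+ k +
    (pi k x * V k x + pi k y * V k y) + A * (u k.+1 - u k) + A * (w k.+1 - w k))))//.
  exact: ler_sum.
rewrite -mulr_sumr !big_split/= -!mulr_sumr.
have tele (v : nat -> R) : (forall k, 0 <= v k <= 1) -> \sum_(k < K) (v k.+1 - v k) <= 1.
  move=> v01; rewrite -(big_mkord xpredT (fun k => v k.+1 - v k)) telescope_sumr//.
  by have := v01 K; have := v01 0%N; lra.
have u01 : \sum_(k < K) (u k.+1 - u k) <= 1.
  by apply: tele => k; rewrite /u ler0n lern1 leq_b1.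
have w01 : \sum_(k < K) (w k.+1 - w k) <= 1.
  by apply: tele => k; rewrite /w ler0n lern1 leq_b1.
rewrite mulrC ler_wpM2r//.
(* The constant is 6 from the geometric series, [2 * (2 + A)] from the slopes at [x] and [y], and
   [2 * A] from the increments of [u] and [w]. *)
have := slope_sum x; have := slope_sum y; have := geometric_sum_le (R := R) K.
have := ler_wpM2l A0 u01; have := ler_wpM2l A0 w01; lra.
Qed.

(** * Selection of the subsequence *)

(** One [q] serves all [h] and [r]: a form of the doubling property, and all that is used of
    Euclidean space. *)
Definition uniform_nets {R : realType} (T : metricType R) (o : T) (q : nat) :=
  forall h r : R, 0 < h -> exists s : seq T,
    (forall x, mdist o x <= r -> exists2 p, p \in s & mdist p x <= h) /\
    (forall x, (size (near_net h s x) <= q)%N).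

Section molecule_mass.
Context {R : realType} {T : metricType R}.
Variables (s : seq (R * (T * T))) (A : R).
Hypothesis sA : \sum_(e <- s) `|e.1| * mdist e.2.1 e.2.2 <= A.

(** Charging both endpoints keeps the functional linear while dominating, for [w >= 0], the larger
    of the two values, which is what the Leibniz rule produces. *)
Definition molecule_mass (w : T -> R) : R :=
  \sum_(e <- s) `|e.1| * mdist e.2.1 e.2.2 * (w e.2.1 + w e.2.2).

Lemma molecule_mass_positive : positive_functional molecule_mass.
Proof.
split=> [f g _ _|a f _|f g _ _ fg].
- rewrite /molecule_mass -big_split/=; apply: eq_bigr => e _; ring.
- rewrite /molecule_mass mulr_sumr; apply: eq_bigr => e _; ring.
- by apply: ler_sum => e _; rewrite ler_wpM2l ?mulr_ge0 ?mdist_ge0// lerD.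
Qed.

Lemma molecule_mass_bound w C : 0 <= C -> (forall x, `|w x| <= C) ->
  `|molecule_mass w| <= A * (2 * C).
Proof.
move=> C0 wC; rewrite (le_trans (ler_norm_sum _ _ _))//.
rewrite (@le_trans _ _ (\sum_(e <- s) `|e.1| * mdist e.2.1 e.2.2 * (2 * C)))//.
  apply: ler_sum => e _; rewrite normrM [X in X * _]ger0_norm ?mulr_ge0 ?mdist_ge0//.
  rewrite ler_wpM2l ?mulr_ge0 ?mdist_ge0// (le_trans (ler_normD _ _))//.
  by have := wC e.2.1; have := wC e.2.2; lra.
by rewrite -mulr_suml ler_wpM2r// mulr_ge0.
Qed.

End molecule_mass.

Section iterated_ultralimit.
Context {R : realType} {X : Type} (U : set_system nat) {UU : UltraFilter U}.
Variables (L : nat -> (X -> R) -> R) (A : R).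
Hypothesis L_pos : forall j, positive_functional (L j).
Hypothesis L_bound : forall j w (C : R), 0 <= C -> (forall x, `|w x| <= C) -> `|L j w| <= A * C.

Definition iterated_ulim (W : nat * X -> R) : R :=
  ulim U (fun m => ulim U (fun j => L j (fun x => W (m, x)))).

Let bound (W : nat * X -> R) (C : R) : (forall i, `|W i| <= C) ->
  forall m j, `|L j (fun x => W (m, x))| <= A * `|C|.
Proof. by move=> WC m j; apply: L_bound => // x; rewrite (le_trans (WC _))// ler_norm. Qed.

Let bound2 (W : nat * X -> R) (C : R) : (forall i, `|W i| <= C) ->
  forall m, `|ulim U (fun j => L j (fun x => W (m, x)))| <= A * `|C|.
Proof. by move=> WC m; apply: ulim_bound; exact: bound. Qed.

Lemma iterated_ulim_positive : positive_functional iterated_ulim.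
Proof.
have slice (W : nat * X -> R) m : bounded_real W -> bounded_real (fun x => W (m, x)).
  by move=> [C WC]; exists C => x.
split=> [f g bf bg|a f bf|f g bf bg fg]; have [C fC] := bf.
- have [D gD] := bg.
  rewrite -(ulimD (bound2 fC) (bound2 gD)); congr (ulim U _); apply/funext => m.
  rewrite -(ulimD (bound fC m) (bound gD m)); congr (ulim U _); apply/funext => j.
  by rewrite (positive_functionalD (L_pos j))//; exact: slice.
- rewrite -(ulimZ _ (bound2 fC)); congr (ulim U _); apply/funext => m.
  rewrite -(ulimZ _ (bound fC m)); congr (ulim U _); apply/funext => j.
  by rewrite (positive_functionalZ (L_pos j))//; exact: slice.
- have [D gD] := bg.
  apply: (ler_ulim (bound2 fC) (bound2 gD)); apply: nearW => m.
  apply: (ler_ulim (bound fC m) (bound gD m)); apply: nearW => j.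
  by apply: (positive_functional_le (L_pos j)) => //; exact: slice.
Qed.

Lemma iterated_ulim_lt (W : nat * X -> R) (C c : R) :
  (forall i, `|W i| <= C) -> iterated_ulim W < c ->
  U [set m | U [set j | L j (fun x => W (m, x)) < c]].
Proof.
move=> WC Wc.
have h := cvgr_lt _ (ulim_cvg (U := U) (bound2 WC)) _ Wc.
have FU : Filter U by exact: filter_filter.
apply: (@filterS _ _ FU _ _ _ (h FU UU)) => m mc.
exact: (cvgr_lt _ (ulim_cvg (U := U) (bound WC m)) _ mc).
Qed.

End iterated_ultralimit.

(** * Smoothing of [lip0] along a sequence of nets *)

Section net_smoothing.
Context {R : realType} {T : metricType R} {o : T}.
Variables (q : nat) (s : nat -> seq T).

Definition mesh m : R := m.+1%:R^-1.

Lemma mesh_gt0 m : 0 < mesh m.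
Proof. by rewrite invr_gt0. Qed.

Lemma mesh_le1 m : mesh m <= 1.
Proof. by rewrite invf_le1// ler1n. Qed.

Lemma mesh_small (e : R) : 0 < e -> \forall m \near \oo, mesh m <= e.
Proof.
by move=> e0; near do apply: ltW; exact: near_infty_natSinv_lt (PosNum e0).
Unshelve. all: by end_near. Qed.

Hypothesis s_cover : forall m x, mdist o x <= 2 * m.+1%:R + 10 ->
  exists2 p, p \in s m & mdist p x <= mesh m.
Hypothesis s_count : forall m x, (size (near_net (mesh m) (s m) x) <= q)%N.

Definition slope m := net_slope o (mesh m) m.+1%:R (s m).

Lemma lip_lip0 (F : lip0 o) (B : R) : `|F| <= B -> lip B (F : T -> R).
Proof.
by move=> FB x y; rewrite (le_trans (lip0_le _ _ _))// ler_wpM2r ?mdist_ge0.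
Qed.

Lemma smooth_lip m (F : lip0 o) (B : R) : `|F| <= B ->
  lip (smoothing_const q * B) (smoothing o (mesh m) m.+1%:R (s m) F).
Proof.
move=> FB x y; rewrite /smoothing opprB addrA subrK.
have B0 : 0 <= B by exact: le_trans FB.
exact: (net_average_lip (mesh_gt0 m) (mesh_le1 m) (ltr0Sn _ _) (@s_cover m) (@s_count m)
  (lip_lip0 FB) B0 (lip0_base F)).
Qed.

Lemma smooth_base m (F : lip0 o) : smoothing o (mesh m) m.+1%:R (s m) F o = 0.
Proof. by rewrite /smoothing subrr. Qed.

Lemma smooth_lipschitz m (F : lip0 o) : lipschitz_const
  (smoothing o (mesh m) m.+1%:R (s m) F : T -> R^o) (smoothing_const q * `|F|).
Proof.
split; last by move=> x y; exact: smooth_lip.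
by rewrite mulr_ge0// addr_ge0// !mulr_ge0// ?addr_ge0// sqr_ge0.
Qed.

Definition smooth m (F : lip0 o) : lip0 o :=
  Lip0 (lip0_in (smooth_lipschitz m F) (smooth_base m F)).

Lemma smooth_local m (F : lip0 o) x y : mdist x y < mesh m ->
  `|smooth m F x - smooth m F y| <= (1 + q%:R) * slope m F x * mdist x y.
Proof.
move=> xy; rewrite /= /smoothing opprB addrA subrK.
exact: (net_average_local (mesh_gt0 m) (mesh_le1 m) (ltr0Sn _ _) (@s_cover m) (@s_count m)).
Qed.

Lemma smooth_near m (F : lip0 o) (B : R) x : `|F| <= B -> mdist o x <= m.+1%:R ->
  `|smooth m F x - F x| <= 18 * mesh m * B.
Proof.
move=> FB ox.
exact: (smoothing_near (mesh_gt0 m) (mesh_le1 m) (ltr0Sn _ _) (@s_cover m)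
  (lip_lip0 FB) (le_trans (normr_ge0 F) FB) (lip0_base F)).
Qed.

Lemma smooth_cvg (F : lip0 o) x : smooth m F x @[m --> \oo] --> (F x : R).
Proof.
apply/cvgrPdist_le => e e0.
have e'0 : 0 < e / (18 * (`|F| + 1)) by rewrite divr_gt0// mulr_gt0// ltr_wpDl.
have [N _ NF] := mesh_small e'0.
exists (maxn N (Num.truncn (mdist o x))) => // m /=.
rewrite geq_max => /andP[Nm xm].
rewrite distrC (le_trans (smooth_near (lexx _) _))//.
  rewrite (le_trans (ltW (truncnS_gt _)))// ler_nat ltnS//.
have := NF m Nm; rewrite /= ler_pdivlMr ?mulr_gt0 ?ltr_wpDl// => h.
apply: le_trans h; have := mesh_gt0 m; have := normr_ge0 F; nra.
Qed.

Lemma slope_ge0 m F x : 0 <= slope m F x.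
Proof. exact: net_slope_ge0 (mesh_gt0 m) _ _. Qed.

End net_smoothing.

(** * Weakly null sequences in [lip0] *)

Section null_sequences.
Context {R : realType} {T : metricType R} {o : T}.
Variables (F : nat -> lip0 o) (B : R).
Hypotheses (FB : forall n, `|F n| <= B).

(** The functions are equi-Lipschitz and balls have finite nets, so pointwise convergence is uniform
    on balls. *)
Lemma null_on_balls q (r e : R) : uniform_nets o q ->
  (forall x, F n x @[n --> \oo] --> (0 : R)) -> 0 < e ->
  \forall n \near \oo, forall x, mdist o x <= r -> `|F n x| <= e.
Proof.
move=> nets F0 e0.
have B0 : 0 <= B by exact: le_trans (FB 0%N).
have B1 : 0 < 2 * (B + 1) by rewrite mulr_gt0// ltr_wpDl.
have h0 : 0 < e / (2 * (B + 1)) by rewrite divr_gt0.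
have [t [t_cover _]] := nets _ r h0.
have : \forall n \near \oo, forall p, p \in t -> `|F n p| <= e / 2.
  elim: t {t_cover} => [|p t IH]; first by near=> n => p; rewrite in_nil.
  near=> n => p'; rewrite inE => /predU1P[->|]; last by move: p'; near: n.
  by near: n; have /cvgr0_norm_le/(_ (e / 2)) := F0 p; apply; rewrite divr_gt0.
apply: filterS => n Fn x xr; have [p pt px] := t_cover x xr.
rewrite -[F n x](subrK (F n p)) (le_trans (ler_normD _ _))// [leRHS]splitr lerD ?Fn//.
rewrite (le_trans (lip0_le _ _ _))// (@le_trans _ _ (B * (e / (2 * (B + 1)))))//.
  by rewrite ler_pM ?mdist_ge0// metric_sym.
by rewrite mulrA ler_pdivrMr//; nra.
Unshelve. all: by end_near. Qed.

Variables (q : nat) (s : nat -> seq T).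
Hypothesis s_count : forall m x, (size (near_net (mesh m : R) (s m) x) <= q)%N.

Lemma slope_le m n x : slope (o := o) s m (F n) x <= q%:R ^+ 2 * (30 * B).
Proof.
have B0 : 0 <= B by exact: le_trans (FB n).
exact: (net_slope_le (mesh_gt0 m) (ltr0Sn _ _) (@s_count m)
  (lip_lip0 (FB n)) B0 (lip0_base (F n))).
Qed.

Lemma slope_norm_le m n x : `|slope (o := o) s m (F n) x| <= q%:R ^+ 2 * (30 * B).
Proof. by rewrite ger0_norm ?slope_ge0// slope_le. Qed.

(** The slope is dominated by [q ^+ 2] quotients. Along any sequence [p] of pairs (level, point),
    the ultralimit of a quotient is a bounded functional [Q] on [lip0], so it tends to 0 on [F n];
    by [ultralimit_null_mean] the means then vanish. *)
Lemma slope_mean_null (U : set_system nat) {UU : UltraFilter U} (L : (nat * T -> R) -> R) :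
  positive_functional L -> \oo `<=` U -> weakly_null F ->
  L (fun mx => slope (o := o) s mx.1 (F n) mx.2) @[n --> \oo] --> (0 : R).
Proof.
move=> L_pos ooU F0.
pose quot (i j : nat) (mx : nat * T) (g : T -> R) :=
  net_quotient o (mesh mx.1) mx.1.+1%:R (s mx.1) mx.2 i j g.
have quot_le (g : lip0 o) i j mx : `|quot i j mx g| <= 30 * `|g|.
  exact: (net_quotient_le _ (mesh_gt0 mx.1) (ltr0Sn _ _) (lip_lip0 (lexx `|g|))
    (normr_ge0 g) (lip0_base g)).
have quotB n i j mx : `|quot i j mx (F n)| <= 30 * B.
  by rewrite (le_trans (quot_le _ _ _ _))// ler_wpM2l.
have null i j : L (fun mx => `|quot i j mx (F n)|) @[n --> \oo] --> (0 : R).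
  apply: (ultralimit_null_mean (phi := fun n mx => quot i j mx (F n)) (C := 30 * B)
    L_pos ooU) => [n mx|]; first exact: quotB.
  move=> p; pose Q (g : lip0 o) : R^o := ulim U (fun K => quot i j (p K) g).
  have Q_lin : linear Q.
    move=> a g g'; rewrite /Q.
    rewrite -[RHS]/(a * ulim U (fun K => quot i j (p K) g) + ulim U (fun K => quot i j (p K) g')).
    rewrite -(@ulimZ _ U _ a _ (30 * `|g|))//.
    rewrite -(@ulimD _ U _ _ _ (`|a| * (30 * `|g|)) (30 * `|g'|))//; last first.
      by move=> K; rewrite normrM ler_wpM2l.
    congr (ulim U _); apply/funext => K.
    rewrite /quot /net_quotient /truncation.
    rewrite -[(a *: g + g') _]/(a * g _ + g' _) -[X in _ - _ * X]/(a * g _ + g' _).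
    by ring.
  have QP : Q \in @dual_pred R (lip0 o).
    by apply: bounded_in_dual Q_lin (_ : forall g, _ <= 30 * `|g|) => g; apply: ulim_bound.
  exact: (F0 (DualSpace QP)).
apply: (@squeeze_cvgr _ _ _ _ (fun=> 0) (fun n => \sum_(i < q) \sum_(j < q)
    L (fun mx => `|quot i j mx (F n)|))).
- near=> n; apply/andP; split.
    apply: (positive_functional_ge0 L_pos) => [|mx]; last exact: slope_ge0.
    by exists (q%:R ^+ 2 * (30 * B)) => mx; exact: slope_norm_le.
  have bquot i j : bounded_real (fun mx => `|quot i j mx (F n)|).
    by apply: bounded_real_norm; exists (30 * B) => mx; exact: quotB.
  rewrite (_ : \sum_(i < q) _ =
      L (fun mx => \sum_(i < q) \sum_(j < q) `|quot i j mx (F n)|)); last first.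
    rewrite (positive_functional_sum L_pos)//; last by move=> i; exact: bounded_real_sum.
    by apply: eq_bigr => i _; rewrite (positive_functional_sum L_pos).
  apply: (positive_functional_le L_pos) => [||mx].
  + by exists (q%:R ^+ 2 * (30 * B)) => mx; exact: slope_norm_le.
  + by do 2!apply: bounded_real_sum => ?.
  + exact: (net_slope_le_quotients _ _ (mesh_gt0 mx.1) (@s_count mx.1)).
- exact: cvg_cst.
- rewrite -[X in _ --> X](_ : \sum_(i < q) \sum_(j < q) 0 = _).
    apply: cvg_big => [|i _]; first exact: add_continuous.
    by apply: cvg_big => [|j _]; [exact: add_continuous|exact: null].
  by rewrite big1// => i _; rewrite big1.
Unshelve. all: by end_near. Qed.

End null_sequences.

Section selection.
Context {R : realType} {T : metricType R} {o : T}.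

(** The loss is the value of [v] at [(1 - pi) * f]. On molecules the Leibniz rule splits it: the
    slope [C] of [f] is paid on the mass of [1 - pi], and the slope [P] of [pi] meets only values of
    [f] at most [e], since [pi] is 1 beyond radius [r]. The term in [eta] is the error of the
    molecular approximation. *)
Lemma cutoff_value (v : dual_space (lip0 o)) (s : seq (R * (T * T))) (f : lip0 o)
    (pi : T -> R) (A C P r e eta t delta : R) :
  \sum_(e <- s) `|e.1| * mdist e.2.1 e.2.2 <= A ->
  (forall g : lip0 o,
    `|v g - \sum_(e <- s) e.1 * (g e.2.1 - g e.2.2)| <= eta * `|g|) ->
  0 <= eta -> 0 <= P -> 0 <= e ->
  lip C f -> lip P pi -> (forall x, 0 <= pi x <= 1) ->
  (forall x, r <= mdist o x -> pi x = 1) ->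
  (forall x, mdist o x < r -> `|f x| <= e) ->
  molecule_mass s (fun x => 1 - pi x) <= t ->
  0 <= C -> eta * (C + P * e) + P * e * A + C * t <= delta ->
  exists2 g : lip0 o, (forall x, g x = pi x * f x) & `|v f| - delta <= `|v g|.
Proof.
move=> sA vs eta0 P0 e0 fC piP pi01 pi1 fe pit C0 small.
pose th x := 1 - pi x.
have th0 x : 0 <= th x by rewrite subr_ge0; have /andP[] := pi01 x.
have th1 x : th x <= 1 by rewrite gerBl; have /andP[] := pi01 x.
have prod x y : `|th x * f x - th y * f y| <=
    Num.max (th x) (th y) * (C * mdist x y) + P * e * mdist x y.
  rewrite (le_trans (normB_mul_le _ _ (th0 x) (th0 y)))// lerD//.
    by rewrite ler_wpM2l// le_max th0.
  have -> : `|th x - th y| = `|pi x - pi y|.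
    by rewrite distrC /th; congr `|_|; ring.
  have e_small z : mdist o z < r -> Num.min `|f x| `|f y| <= `|f z| ->
      Num.min `|f x| `|f y| * `|pi x - pi y| <= P * e * mdist x y.
    move=> zr mz; rewrite mulrC mulrAC ler_pM// ?le_min ?normr_ge0// ?piP//.
    exact: le_trans mz (fe z zr).
  have [xr|xr] := ltP (mdist o x) r; first by apply: (e_small x) => //; rewrite ge_min lexx.
  have [yr|yr] := ltP (mdist o y) r.
    by apply: (e_small y) => //; rewrite ge_min lexx orbT.
  by rewrite !pi1// subrr normr0 mulr0 !mulr_ge0 ?mdist_ge0.
have CPe : 0 <= C + P * e by rewrite addr_ge0// mulr_ge0.
have thf_lip : lipschitz_const (fun x => th x * f x : R^o) (C + P * e).
  split => // x y; rewrite (le_trans (prod x y))// mulrDl lerD2r.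
  by rewrite ler_piMl ?mulr_ge0 ?mdist_ge0// ge_max !th1.
have thf_base : th o * f o = 0 by rewrite lip0_base mulr0.
pose w := Lip0 (lip0_in thf_lip thf_base).
exists (f - w) => [x|].
  by rewrite -[LHS]/(f x - th x * f x) /th mulrBl mul1r opprB addrC subrK.
rewrite dualB; apply: le_trans (lerB_dist _ _); rewrite lerD2l lerN2.
rewrite (le_trans _ small)//.
rewrite -[v w](subrK (\sum_(e <- s) e.1 * (w e.2.1 - w e.2.2))).
rewrite (le_trans (ler_normD _ _))// -addrA lerD//.
  by rewrite (le_trans (vs w))// ler_wpM2l//; apply: lip0_norm_bound CPe _ => x y; exact: thf_lip.2.
rewrite (le_trans (ler_norm_sum _ _ _))//.
rewrite (@le_trans _ _ (P * e * (\sum_(e <- s) `|e.1| * mdist e.2.1 e.2.2) +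
    C * molecule_mass s th))//; last first.
  by rewrite lerD// ?ler_wpM2l// mulr_ge0.
rewrite /molecule_mass !mulr_sumr -big_split/=; apply: ler_sum => c _.
have max_le : Num.max (th c.2.1) (th c.2.2) <= th c.2.1 + th c.2.2.
  by rewrite ge_max lerDl lerDr !th0.
rewrite normrM (le_trans (ler_wpM2l (normr_ge0 _) (prod c.2.1 c.2.2)))//.
have := ler_wpM2r (mulr_ge0 (normr_ge0 c.1) (mulr_ge0 C0 (mdist_ge0 c.2.1 c.2.2))) max_le.
lra.
Qed.

End selection.

(* A step of the inductive choice of [n_k] ([stage_index]) and [m_k] ([stage_level]).
   The product of the cutoffs so far is 1 outside the ball of radius [stage_radius], and
   only the molecules of [v j], [j] in [stage_allowed], give small mass to the
   complement of this product, so that the next index is taken there. *)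
Record stage {R : realType} {T : metricType R} := Stage {
  stage_cutoff : T -> R ;
  stage_radius : R ;
  stage_mesh : R ;
  stage_allowed : set nat ;
  stage_index : nat ;
  stage_level : nat }.

Section stages.
Context {R : realType} {T : metricType R} {o : T}.
Variables (q : nat) (s : nat -> seq T).
Hypothesis nets : uniform_nets o q.
Hypothesis s_cover : forall m x, mdist o x <= 2 * m.+1%:R + 10 ->
  exists2 p, p \in s m & mdist p x <= (mesh m : R).
Hypothesis s_count : forall m x, (size (near_net (mesh m : R) (s m) x) <= q)%N.

Let S := smooth s_cover s_count.
Let W := slope (o := o) s.

(** The average is bounded by [b] and vanishes beyond radius [r], so a point at distance
    [2 ^+ k * b] from that ball only has difference quotients of size at most [2^-1 ^+ k]. The
    smoothing differs from the average by a constant. *)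
Lemma smooth_far m (F : lip0 o) (B : R) k : `|F| <= B -> exists r : R, forall x, r <= mdist o x ->
  W m F x = 0 /\ forall y, `|S m F x - S m F y| <= 2^-1 ^+ k * mdist x y.
Proof.
move=> FB; have B0 : 0 <= B by exact: le_trans FB.
have m0 : 0 < m.+1%:R :> R by [].
have F_lip := lip_lip0 FB; have Fo := lip0_base F.
pose r : R := 2 * m.+1%:R + 9; pose b := 3 * B * r + 9 * B.
have r0 : 0 <= r by rewrite /r addr_ge0// mulr_ge0.
have b0 : 0 <= b by rewrite addr_ge0 ?mulr_ge0.
pose avg := net_average o (mesh m) m.+1%:R (s m) F.
have avg0 x : r <= mdist o x -> avg x = 0.
  move=> rx; apply: (net_average_eq0 (s m) (mesh_gt0 m) (mesh_le1 m) m0).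
  by move: rx; rewrite /r; lra.
have avg_le x : mdist o x <= r -> `|avg x| <= b.
  move=> xr.
  have := net_average_near (mesh_gt0 m) (mesh_le1 m) m0 (@s_cover m) F_lip B0 Fo x.
  have := truncation_lip m0 F_lip B0 Fo x o.
  rewrite [truncation _ _ _ o]/truncation Fo mulr0 subr0 metric_sym => Gx near.
  rewrite -[avg x](subrK (truncation o m.+1%:R F x)) (le_trans (ler_normD _ _))//.
  rewrite addrC lerD//.
    by rewrite (le_trans Gx)// ler_wpM2l// mulr_ge0.
  by rewrite (le_trans near)// ler_wpM2r// ler_piMr// mesh_le1.
have q2 : 0 < 2 ^+ k :> R by rewrite exprn_gt0.
exists (r + 2 ^+ k * b) => x rx.
have rx' : r <= mdist o x by rewrite (le_trans _ rx)// lerDl mulr_ge0// ltW.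
split; first exact: (net_slope_eq0 (s m) (mesh_gt0 m) (mesh_le1 m) m0).
move=> y; rewrite -[S m F x]/(avg x - avg o) -[S m F y]/(avg y - avg o).
rewrite opprB addrA subrK (avg0 x rx') sub0r normrN.
have [ry|yr] := leP r (mdist o y).
  by rewrite avg0// normr0 mulr_ge0 ?mdist_ge0// exprn_ge0// invr_ge0.
rewrite (le_trans (avg_le _ (ltW yr)))// exprVn ler_pdivlMl//.
by have := metric_triangle o y x; rewrite (metric_sym y); lra.
Qed.

Variables (v : nat -> dual_space (lip0 o)) (F : nat -> lip0 o) (A B delta : R).
Variables (mol : nat -> seq (R * (T * T))) (U : set_system nat).
Context {UU : UltraFilter U}.

Let C := smoothing_const q * B.
(** The cutoffs together lose mass at most [2 * t], and [C * (2 * t) <= delta / 16]. *)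
Let t := delta / (32 * (C + 1)).

(** Step [k] loses mass at most [t * 2^-1 ^+ k], and the bound sums the losses of the earlier steps.
    The Lipschitz constant [P] may grow with [k]. *)
Definition stage_inv (k : nat) (st : @stage R T) :=
  [/\ exists2 P, 0 <= P & lip P (stage_cutoff st),
      forall x, 0 <= stage_cutoff st x <= 1,
      forall x, stage_radius st <= mdist o x -> stage_cutoff st x = 1,
      0 < stage_mesh st &
      U (stage_allowed st) /\ forall j, stage_allowed st j ->
        molecule_mass (mol j) (fun x => 1 - stage_cutoff st x) <= t * (2 - 2 * 2^-1 ^+ k)].

Definition stage_fun (st : @stage R T) := S (stage_level st) (F (stage_index st)).

Definition stage_slope (st : @stage R T) x :=
  (1 + q%:R) * W (stage_level st) (F (stage_index st)) x.

(** The function of [st'] is multiplied by the cutoff of [st]; the cutoff of [st'] already takes the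
    slope of that function into account. *)
Definition stage_next (k : nat) (st st' : @stage R T) :=
  [/\ (k <= stage_index st')%N,
      (forall x, stage_cutoff st' x =
        stage_cutoff st x * (1 - Num.min 1 (2 ^+ k * stage_slope st' x))) /\
      (stage_mesh st' = mesh (stage_level st') /\ stage_mesh st' <= stage_mesh st /\
       stage_radius st <= stage_radius st'),
      forall x, mdist o x < stage_radius st -> `|stage_fun st' x| <= 2^-1 ^+ k * stage_mesh st,
      (forall x y, mdist o x < stage_radius st ->
        `|stage_fun st' x| * `|stage_cutoff st x - stage_cutoff st y| <=
          2^-1 ^+ k * mdist x y) /\
      (forall x y, stage_radius st' <= mdist o x ->
        `|stage_fun st' x - stage_fun st' y| <= 2^-1 ^+ k * mdist x y) &
      exists2 g : lip0 o, (forall x, g x = stage_cutoff st x * stage_fun st' x) &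
        delta / 2 <= `|v (stage_index st') g|].

Lemma stage_step : (forall n, v n \in @free_pred R T o) ->
  (forall n, `|F n| <= B) -> weakly_null F ->
  (forall n, \sum_(e <- mol n) `|e.1| * mdist e.2.1 e.2.2 <= A) ->
  (forall n (f : lip0 o),
    `|v n f - \sum_(e <- mol n) e.1 * (f e.2.1 - f e.2.2)| <= mesh n * `|f|) ->
  \oo `<=` U -> 0 < delta -> U [set n | delta <= `|v n (F n)|] ->
  forall k st, stage_inv k st -> exists st', stage_inv k.+1 st' /\ stage_next k st st'.
Proof.
move=> vo FB F0 molA molv ooU delta0 Uv k st [[P P0 piP] pi01 pi1 h0 [UJ Jt]].
set pi := stage_cutoff st in piP pi01 pi1 Jt *.
set r := stage_radius st in pi1 *; set h := stage_mesh st in h0 *.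
set J := stage_allowed st in UJ Jt *.
have FU : Filter U by exact: filter_filter.
have B0 : 0 <= B by exact: le_trans (FB 0%N).
have A0 : 0 <= A by apply: le_trans (molA 0%N); apply: sumr_ge0 => e _; rewrite mulr_ge0 ?mdist_ge0.
have C0 : 0 <= C.
  by rewrite mulr_ge0// addr_ge0// !mulr_ge0// ?addr_ge0// sqr_ge0.
have t0 : 0 < t by rewrite divr_gt0// mulr_gt0// ltr_wpDl.
have tC : C * (2 * t) <= delta / 16.
  rewrite /t; have C1 : 0 < C + 1 by rewrite ltr_wpDl.
  rewrite (_ : C * (2 * (delta / (32 * (C + 1)))) = delta / 16 * (C / (C + 1))); last first.
    by field; rewrite gt_eqF.
  by rewrite ler_piMr ?divr_ge0 ?(ltW delta0)// ler_pdivrMr// mul1r lerDl.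
have q2 : 0 < 2 ^+ k :> R by rewrite exprn_gt0.
have qV2 : 0 < 2^-1 ^+ k :> R by rewrite exprn_gt0// invr_gt0.
have q1 : 0 < 1 + q%:R :> R by rewrite ltr_pwDl.
(* [e] bounds the next function on the support of the current cutoffs. *)
pose D := (P + 1) * (A + 1).
have D1 : 1 <= D by rewrite /D; nra.
have D0 : 0 < D by rewrite (lt_le_trans _ D1).
pose e0 := Num.min (2^-1 ^+ k * Num.min h 1) (delta / 16).
have e00 : 0 < e0.
  by rewrite lt_min; apply/andP; split; [rewrite mulr_gt0// lt_min h0 ltr01|rewrite divr_gt0].
pose e := e0 / D.
have e_gt0 : 0 < e by rewrite divr_gt0.
have eD : e * D = e0 by rewrite /e divfK ?gt_eqF.
have e0_le1 : e0 <= 2^-1 ^+ k * Num.min h 1 by rewrite ge_min lexx.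
have e0_le2 : e0 <= delta / 16 by rewrite ge_min lexx orbT.
have e_le0 : e <= e0 by rewrite -eD ler_peMr// ltW.
have eh : e <= 2^-1 ^+ k * h.
  by rewrite (le_trans e_le0)// (le_trans e0_le1)// ler_pM2l// ge_min lexx.
have Pe0 : 0 <= P * e by rewrite mulr_ge0// ltW.
have PAe0 : 0 <= A * e by rewrite mulr_ge0// ltW.
have PAPe0 : 0 <= P * e * A by rewrite mulr_ge0.
have eDE : e * D = P * e * A + P * e + A * e + e by rewrite /D; ring.
have Pe_le : P * e <= 2^-1 ^+ k.
  rewrite (@le_trans _ _ e0)//; first by rewrite -eD eDE; have := ltW e_gt0; lra.
  by rewrite (le_trans e0_le1)// ler_piMr ?(ltW qV2)// ge_min lexx orbT.
have PeA_le : P * e * A <= delta / 16.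
  by rewrite (le_trans _ e0_le2)// -eD eDE; have := ltW e_gt0; lra.
have Pe_le1 : P * e <= 1.
  by rewrite (le_trans Pe_le)// exprn_ile1// ?invr_ge0// invf_le1// ler1n.
pose L := iterated_ulim U (fun j w => molecule_mass (mol j) w).
have mass_bound j w (c : R) : 0 <= c -> (forall x, `|w x| <= c) ->
    `|molecule_mass (mol j) w| <= A * 2 * c.
  by move=> c0 wc; rewrite -mulrA; exact: (molecule_mass_bound (molA j) c0 wc).
have L_pos : positive_functional L.
  apply: (iterated_ulim_positive (A := A * 2)) => //.
  by move=> j; exact: molecule_mass_positive.
(* The new factor of the cutoff loses at most [2 ^+ k * (1 + q%:R)] times the mass of the slope,
   hence at most [t * 2^-1 ^+ k]. *)
pose c := t * 2^-1 ^+ k / (2 ^+ k * (1 + q%:R)).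
have c0 : 0 < c by apply: divr_gt0; apply: mulr_gt0.
have F_cvg0 x : F n x @[n --> \oo] --> (0 : R) by exact: (F0 (evaluation o x)).
have U1 : U [set n | L (fun mx => W mx.1 (F n) mx.2) < c].
  have L0 : L (fun mx => W mx.1 (F n) mx.2) @[n --> \oo] --> (0 : R).
    exact: (slope_mean_null FB s_count L_pos ooU F0).
  by apply: ooU; exact: (cvgr_lt _ L0 _ c0).
have U2 : U [set n | forall x, mdist o x <= r -> `|F n x| <= e / 2].
  by apply: ooU; apply: (null_on_balls FB r nets F_cvg0); rewrite divr_gt0.
have U3 : U [set n | (k <= n)%N] by apply: ooU; exists k.
have C2 : 0 < C + 2 by rewrite ltr_wpDl.
have U4 : U [set n | mesh n <= delta / 16 / (C + 2)].
  by apply: ooU; apply: mesh_small; rewrite !divr_gt0.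
have [n [[Jn nv] [[nL nF] [kn ne]]]] :=
  filter_ex (filterI (filterI UJ Uv) (filterI (filterI U1 U2) (filterI U3 U4))).
have V1 : U [set m | U [set j | molecule_mass (mol j) (fun x => W m (F n) x) < c]].
  exact: (iterated_ulim_lt (A := A * 2) mass_bound
    (fun mx => slope_norm_le FB s_count mx.1 n mx.2) nL).
have e'0 : 0 < e / 2 / (18 * (B + 1)) by rewrite !divr_gt0// mulr_gt0// ltr_wpDl.
have V2 : U [set m | mesh m <= e / 2 / (18 * (B + 1))] by apply: ooU; exact: mesh_small.
have V3 : U [set m | mesh m <= h] by apply: ooU; exact: mesh_small.
have V4 : U [set m | r <= m.+1%:R].
  apply: ooU; exists (Num.truncn r) => // m /= rm.
  by rewrite (le_trans (ltW (truncnS_gt _)))// ler_nat.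
have V5 : U [set m | delta * (3 / 4) <= `|v n (S m (F n))|].
  apply: ooU.
  have S_cvg : v n (S m (F n)) @[m --> \oo] --> (v n (F n) : R).
    apply: (@free_bounded_cvg _ _ _ _ _ _ C) => // [m|x].
      by apply: lip0_norm_bound => // x y; exact: smooth_lip.
    exact: smooth_cvg.
  move/cvg_norm in S_cvg; have := cvgr_ge _ S_cvg (delta * (3 / 4)).
  by apply; rewrite /= in nv; lra.
have [m [[mW me] [[mh mr] mv]]] :=
  filter_ex (filterI (filterI V1 V2) (filterI (filterI V3 V4) V5)).
have Sm_lip : lip C (S m (F n)) by exact: smooth_lip.
have S_small x : mdist o x < r -> `|S m (F n) x| <= e.
  move=> xr; rewrite -[S m (F n) x](subrK (F n x)) (le_trans (ler_normD _ _))//.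
  rewrite [leRHS]splitr lerD//; last by rewrite nF// ltW.
  rewrite (le_trans (smooth_near _ _ (FB n) _))//; first by rewrite (le_trans _ mr)// ltW.
  move: me; rewrite /= ler_pdivlMr ?mulr_gt0 ?ltr_wpDl// => me.
  by rewrite (le_trans _ me)//; have := mesh_gt0 (R := R) m; nra.
have pit : molecule_mass (mol n) (fun x => 1 - pi x) <= 2 * t.
  by rewrite (le_trans (Jt n Jn))// mulrC ler_pM2r// gerBl mulr_ge0// ltW.
(* Three losses of at most [delta / 16] each: the molecular error, the slope of the cutoff, and the
   mass where the cutoff is not 1. *)
have [g gE gv] : exists2 g : lip0 o, (forall x, g x = pi x * S m (F n) x) &
    `|v n (S m (F n))| - delta / 4 <= `|v n g|.
  apply: (cutoff_value (e := e) (P := P) (C := C) (r := r) (eta := mesh n) (t := 2 * t)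
    (molA n) (molv n)) => //.
  - exact: ltW (mesh_gt0 n).
  - exact: ltW.
  - have : mesh n * (C + P * e) <= delta / 16.
      move: ne; rewrite /= ler_pdivlMr// => ne; apply: le_trans ne.
      by rewrite ler_wpM2l ?(ltW (mesh_gt0 n))// lerD2l; lra.
    by move: PeA_le tC; lra.
have [r' r'P] := smooth_far m k (FB n).
pose psi x := Num.min 1 (2 ^+ k * ((1 + q%:R) * W m (F n) x)).
have W0 x : 0 <= W m (F n) x by exact: slope_ge0.
have psi0 x : 0 <= psi x by rewrite le_min ler01 mulr_ge0 ?(ltW q2)// mulr_ge0// ltW.
have psi1 x : psi x <= 1 by rewrite ge_min lexx.
(* Beyond [r'] the slope vanishes, so the new cutoff is 1 beyond both radii. The allowed indices
   shrink to those whose molecules hardly see the slope of the new function. *)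
pose st' := Stage (fun x => pi x * (1 - psi x)) (Num.max r r') (mesh m)
  (J `&` [set j | molecule_mass (mol j) (fun x => W m (F n) x) < c]) n m.
exists st'; split; last first.
  split => //.
  - by split => //; split => //; split => //=; rewrite le_max lexx.
  - by move=> x xr; rewrite (le_trans (S_small _ xr)).
  - split=> x y /= xr.
      rewrite (le_trans (ler_pM _ _ (S_small _ xr) (piP x y)))//.
      by rewrite mulrA (mulrC e) ler_wpM2r ?mdist_ge0.
    by apply: (r'P x _).2; rewrite (le_trans _ xr)// le_max lexx orbT.
  - by exists g => //; rewrite (le_trans _ gv)//; move: mv => /=; lra.
have [K K0 WK] : exists2 K, 0 <= K & lip K (W m (F n)).
  exact: net_slope_lip (mesh_gt0 m) _.
split => /=.
- exists (P + 2 ^+ k * ((1 + q%:R) * K)) => [|x y].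
    by rewrite addr_ge0// mulr_ge0 ?(ltW q2)// mulr_ge0// ltW.
  have psi_lip : `|psi x - psi y| <= 2 ^+ k * ((1 + q%:R) * K) * mdist x y.
    have : `|2 ^+ k * ((1 + q%:R) * W m (F n) x) - 2 ^+ k * ((1 + q%:R) * W m (F n) y)| <=
        2 ^+ k * ((1 + q%:R) * K) * mdist x y.
      rewrite -!mulrBr !normrM (gtr0_norm q2) (gtr0_norm q1) -!mulrA.
      by rewrite ler_pM2l// ler_pM2l// WK.
    apply: le_trans; rewrite /psi; move: (2 ^+ k * _) (2 ^+ k * _) => a b.
    case: (leP 1 a) => ha; case: (leP 1 b) => hb; rewrite ler_norml;
      have := ler_norm (a - b); have := ler_norm (b - a); rewrite (distrC b); lra.
  have /andP[px0 px1] := pi01 x; have /andP[py0 py1] := pi01 y.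
  rewrite (le_trans (normB_mul_le _ _ px0 py0))// mulrDl addrC lerD//.
    rewrite -[leRHS]mul1r ler_pM ?le_min ?normr_ge0//.
    by rewrite ge_min ger0_norm ?subr_ge0 ?psi1// gerBl psi0.
  apply: le_trans psi_lip; rewrite -[leRHS]mul1r ler_pM ?le_max ?px0//.
    by rewrite ge_max px1.
  by rewrite distrC (_ : _ - _ = psi x - psi y)//; ring.
- move=> x; have /andP[px0 px1] := pi01 x.
  by rewrite mulr_ge0 ?subr_ge0//= mulr_ile1 ?subr_ge0// gerBl.
- move=> x; rewrite ge_max => /andP[rx r'x].
  by rewrite pi1// /psi (r'P x r'x).1 !mulr0 min_r// subr0 mulr1.
- exact: mesh_gt0.
- split=> [|j [Jj jW]]; first exact: filterI.
  have mass_pos := molecule_mass_positive (mol j).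
  have bpi : bounded_real (fun x => 1 - pi x).
    exists 1 => x; have /andP[px0 px1] := pi01 x.
    by rewrite ger0_norm ?subr_ge0// gerBl.
  have bW : bounded_real (W m (F n)).
    by exists (q%:R ^+ 2 * (30 * B)) => x; exact: slope_norm_le.
  have bW' : bounded_real (fun x => 2 ^+ k * (1 + q%:R) * W m (F n) x).
    by apply: bounded_realM => //; exact: bounded_real_cst.
  have : molecule_mass (mol j) (fun x => 1 - pi x * (1 - psi x)) <=
      molecule_mass (mol j) (fun x => (1 - pi x) + 2 ^+ k * (1 + q%:R) * W m (F n) x).
    apply: (positive_functional_le mass_pos) => [||x].
    + exists 1 => x; have /andP[px0 px1] := pi01 x.
      have pp0 : 0 <= pi x * (1 - psi x) by rewrite mulr_ge0// subr_ge0.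
      have pp1 : pi x * (1 - psi x) <= 1 by rewrite mulr_ile1 ?subr_ge0// gerBl.
      by rewrite ger0_norm ?subr_ge0// gerBl.
    + exact: bounded_realD.
    + have /andP[px0 px1] := pi01 x.
      have : psi x <= 2 ^+ k * (1 + q%:R) * W m (F n) x.
        by rewrite /psi -mulrA ge_min lexx orbT.
      by have := ler_wpM2r (psi0 x) px1; lra.
  move=> /le_trans; apply.
  rewrite (positive_functionalD mass_pos)// (positive_functionalZ mass_pos)//.
  have qq : 0 < 2 ^+ k * (1 + q%:R) :> R by rewrite mulr_gt0.
  have : 2 ^+ k * (1 + q%:R) * molecule_mass (mol j) (W m (F n)) <= t * 2^-1 ^+ k.
    by rewrite mulrC -ler_pdivlMr// ltW.
  by have := Jt j Jj; rewrite exprS; lra.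
Qed.

End stages.

Lemma free_pairing_null {R : realType} {T : metricType R} (o : T) (q : nat)
    (v : nat -> dual_space (lip0 o)) (F : nat -> lip0 o) (A B : R) :
  uniform_nets o q -> (forall n, v n \in @free_pred R T o) -> (forall n, `|v n| <= A) ->
  (forall g, v n g @[n --> \oo] --> (0 : R)) ->
  weakly_null F -> (forall n, `|F n| <= B) -> v n (F n) @[n --> \oo] --> (0 : R).
Proof.
move=> nets vo vA v0 F0 FB; apply/cvgrPdist_lt => delta delta0; apply: contrapT => nolim.
have B0 : 0 <= B by exact: le_trans (FB 0%N).
have [U [UU ooU Uv]] : exists U : set_system nat,
    [/\ UltraFilter U, \oo `<=` U & U [set n | delta <= `|v n (F n)|]].
  apply: ultrafilter_frequently => N; apply: contrapT => noN; apply: nolim.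
  exists N => // n /= Nn; rewrite sub0r normrN ltNge; apply/negP => dv.
  by apply: noN; exists n.
have [s sP] := choice (fun m => nets (mesh m) (2 * m.+1%:R + 10) (mesh_gt0 m)).
have s_cover m x := (sP m).1 x; have s_count m x := (sP m).2 x.
have [mol molP] := choice (fun n => free_molecules (vo n) (mesh_gt0 n)).
have molA n : \sum_(e <- mol n) `|e.1| * mdist e.2.1 e.2.2 <= A + 1.
  by rewrite (le_trans (molP n).1)// lerD2r.
have step := @stage_step R T o q s nets s_cover s_count v F (A + 1) B delta mol U UU vo FB F0
  molA (fun n => (molP n).2) ooU delta0 Uv.
have [|st [st0 stP]] := @dependent_choice _ (Stage (fun=> 1) 0 1 setT 0 0) _ _ _ step.
  split => //=.
  - by exists 0 => // x y; rewrite subrr normr0 mul0r.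
  - by move=> x; rewrite ler01 lexx.
  - split=> [|j _]; first exact: filterT.
    rewrite expr0 mulr1 !subrr mulr0 /molecule_mass big1// => e _.
    by rewrite addr0 mulr0.
pose C : R := smoothing_const q * B.
pose f k : lip0 o := stage_fun s_cover s_count F (st k.+1).
pose V k x := @stage_slope R T o q s F (st k.+1) x.
(* The same [C] bounds the slopes with their factor [1 + q%:R] and the Lipschitz constants of the
   [f k]. *)
have VC k x : 0 <= V k x <= C.
  have q1 : 0 <= 1 + q%:R :> R by rewrite addr_ge0.
  rewrite /V /stage_slope mulr_ge0 ?slope_ge0//=.
  rewrite (le_trans (ler_wpM2l q1 (slope_le FB s_count _ _ _)))//.
  by rewrite /C /smoothing_const; lra.
have /choice[g gP] k : exists gk : lip0 o, (forall x,gk x = stage_cutoff (st k) x * f k x) /\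
    delta / 2 <= `|v (stage_index (st k.+1)) gk|.
  have [_ [_ _ _ _ [gk gkE gkv]]] := stP k.
  by exists gk.
apply: (@weakly_unconditionally_cauchy_null _ _ _ g (10 + 4 * C) (delta / 2)
  (fun k => v (stage_index (st k.+1)))).
- by rewrite divr_gt0.
- move=> K x y; under eq_bigr do rewrite !(gP _).1.
  apply: (@cutoff_products_summable _ _ o f V (fun k => stage_cutoff (st k))
    (fun k => stage_mesh (st k)) (fun k => stage_radius (st k)) C).
  + by rewrite st0.
  + by move=> k z; have [_ [_ [piE _] _ _ _]] := stP k.
  + exact: VC.
  + by move=> k z z'; exact: smooth_lip.
  + move=> k z z'; have [_ [_ [_ [-> _]] _ _ _]] := stP k.
    exact: smooth_local.
  + by move=> k; have [_ [_ [_ [_ [? _]]] _ _ _]] := stP k.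
  + by move=> k; have [_ [_ [_ [_ [_ ?]]] _ _ _]] := stP k.
  + by move=> k; have [_ [_ _ ? _ _]] := stP k.
  + by move=> k; have [[_ _ ? _ _] _] := stP k.
  + by move=> k; have [_ [_ _ _ [? _] _]] := stP k.
  + by move=> k; have [_ [_ _ _ [_ ?] _]] := stP k.
- by [].
(* It is enough that the index chosen at step [k] is at least [k]; the indices need not increase. *)
- move=> u; apply/cvgrPdist_lt => e e0.
  have [N _ NP] := (cvgrPdist_lt _ _).1 (v0 u) e e0.
  exists N => // k /= Nk; apply: NP; have [_ [ki _ _ _ _]] := stP k.
  exact: leq_trans ki.
- by move=> k; exact: (gP k).2.
Qed.

(** * Nets in subsets of Euclidean spaces *)

Section euclidean_nets.
Context {R : realType} {d : nat} (M : set (euclidean R d)) (o : M).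

Definition coord (x : M) (i : 'I_d) : R := (set_val x : 'rV[R]_d) 0 i - (set_val o : 'rV[R]_d) 0 i.

Lemma mdist_subset (x y : M) : mdist x y = Num.sqrt (\sum_(i < d) (coord x i - coord y i) ^+ 2).
Proof.
rewrite -[mdist x y]/(euclidean_dist (set_val x) (set_val y)) /euclidean_dist.
by congr Num.sqrt; apply: eq_bigr => i _; congr (_ ^+ 2); rewrite /coord; ring.
Qed.

Lemma coord_le_mdist (x y : M) i : `|coord x i - coord y i| <= mdist x y.
Proof.
rewrite mdist_subset -sqrtr_sqr ler_wsqrtr// (bigD1 i)//= lerDl.
by apply: sumr_ge0 => j _; exact: sqr_ge0.
Qed.

Lemma mdist_le_coord (x y : M) (a : R) : 0 <= a -> (forall i, `|coord x i - coord y i| <= a) ->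
  mdist x y <= d%:R * a.
Proof.
move=> a0 xya; rewrite mdist_subset -[leRHS]ger0_norm ?mulr_ge0// -sqrtr_sqr ler_wsqrtr//.
rewrite (@le_trans _ _ (\sum_(i < d) a ^+ 2))//.
  by apply: ler_sum => i _; rewrite -real_normK ?num_real// lerXn2r ?nnegrE.
rewrite sumr_const card_ord -[leLHS]mulr_natl exprMn ler_wpM2r ?sqr_ge0//.
by rewrite -natrX ler_nat; case: (d) => // n; rewrite expnS expn1 leq_pmulr.
Qed.

Lemma floorB_le (u w : R) (c : nat) : `|u - w| <= c%:R -> (absz (Num.floor u - Num.floor w) <= c)%N.
Proof.
have floor_le_add (a b : R) : a - b <= c%:R -> Num.floor a - Num.floor b <= c%:Z.
  move=> ab; rewrite lerBlDl -ltzD1 -(ltr_int R) (le_lt_trans (floor_le _))//.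
  have := floorD1_gt b; rewrite !intrD /= -pmulrn; lra.
rewrite ler_norml => /andP[wu uw]; rewrite -lez_nat abszE ler_norml floor_le_add ?andbT//.
by rewrite lerNl opprB floor_le_add//; lra.
Qed.

(** Shifting by [D] moves the integers from [-D] to [D] into the range of [inord], which returns a
    default value elsewhere; hence the bounds in [cell_code_inj]. *)
Definition cell_code (D : nat) (z : 'I_d -> int) : {ffun 'I_d -> 'I_(2 * D).+1} :=
  [ffun i => inord (absz (z i + D%:Z))].

Lemma cell_code_inj (D : nat) (z w : 'I_d -> int) :
  (forall i, (absz (z i) <= D)%N) -> (forall i, (absz (w i) <= D)%N) ->
  cell_code D z = cell_code D w -> z =1 w.
Proof.
move=> zD wD zw i; have := congr1 (fun f : {ffun _ -> _} => val (f i)) zw.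
rewrite !ffunE /=; have := zD i; have := wD i => wi zi.
by rewrite !inordK; lia.
Qed.

(** One representative in [M] is kept for each cube of side [a = h / d.+1] that contains a point of
    the ball of [M]; two points of a cube are within [d * a <= h]. Within [5 * h] of [x] the integer
    coordinates differ from those of [x] by at most [5 * d.+1], so the count depends on [d] only.
    Using [d.+1] also covers [d = 0]. *)
Lemma euclidean_uniform_nets : exists q, uniform_nets o q.
Proof.
pose D := (5 * d.+1)%N; exists #|{ffun 'I_d -> 'I_(2 * D).+1}| => h r h0.
pose a : R := h / d.+1%:R; have a0 : 0 < a by rewrite divr_gt0.
pose Z (x : M) (i : 'I_d) : int := Num.floor (coord x i / a).
have Z_le (x y : M) (c : nat) : mdist x y <= c%:R * a -> forall i, (absz (Z x i - Z y i) <= c)%N.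
  move=> xyc i; apply: floorB_le; rewrite -mulrBl normrM [`|a^-1|]gtr0_norm ?invr_gt0//.
  by rewrite ler_pdivrMr// (le_trans (coord_le_mdist _ _ _)).
have Zo i : Z o i = 0 by rewrite /Z /coord subrr mul0r floor0.
have Z_eq (x y : M) : Z x =1 Z y -> mdist x y <= h.
  move=> xy; rewrite (@le_trans _ _ (d%:R * a))//.
    apply: mdist_le_coord => [|i]; first exact: ltW.
    have := floor_itv (coord x i / a); have := floor_itv (coord y i / a).
    rewrite -/(Z x i) -/(Z y i) xy intrD => /andP[y1 y2] /andP[x1 x2].
    have : `|coord x i / a - coord y i / a| <= 1 by rewrite ler_norml; lra.
    by rewrite -mulrBl normrM [`|a^-1|]gtr0_norm ?invr_gt0// ler_pdivrMr// mul1r.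
  by rewrite /a mulrA ler_pdivrMr// mulrC ler_pM2l// ler_nat.
pose N := (Num.truncn (`|r| / a)).+1.
have Z_ball x : mdist o x <= r -> forall i, (absz (Z x i) <= N)%N.
  move=> xr i; rewrite -[Z x i]subr0 -(Zo i); apply: Z_le.
  rewrite metric_sym (le_trans xr)// (le_trans (ler_norm r))// -ler_pdivrMr//.
  by rewrite ltW// truncnS_gt.
pose code x := cell_code N (Z x).
pose inhab c := exists x, mdist o x <= r /\ code x = c.
have /choice[rep repP] c : exists x, inhab c -> mdist o x <= r /\ code x = c.
  by have [[x ?]|nc] := pselect (inhab c); [exists x|exists o].
pose s := [seq rep c | c <- enum {ffun 'I_d -> 'I_(2 * N).+1} & `[< inhab c >]].
have s_code p : p \in s -> [/\ mdist o p <= r, inhab (code p) & rep (code p) = p].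
  move=> /mapP[c]; rewrite mem_filter => /andP[/asboolP ic _] ->.
  by have [? cE] := repP c ic; rewrite cE.
exists s; split=> [x xr|x].
  have ix : inhab (code x) by exists x.
  have [pr px] := repP _ ix; exists (rep (code x)).
    by apply: map_f; rewrite mem_filter mem_enum andbT; apply/asboolP.
  by apply: Z_eq; apply: cell_code_inj px; exact: Z_ball.
(* Codes relative to the cube of [x] are injective on the near points, because each cube has a
   single representative. *)
rewrite -(size_map (fun p => cell_code D (fun i => Z p i - Z x i))).
rewrite cardE; apply: uniq_leq_size => [|c _]; last by rewrite mem_enum.
rewrite map_inj_in_uniq => [|p p'].
  apply: filter_uniq; rewrite map_inj_in_uniq => [|c c'].
    by apply: filter_uniq; exact: enum_uniq.
  rewrite !mem_filter => /andP[/asboolP ic _] /andP[/asboolP ic' _] cc'.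
  by rewrite -(repP c ic).2 -(repP c' ic').2 cc'.
rewrite !mem_filter => /andP[px ps] /andP[p'x p's] pp'.
have [_ _ <-] := s_code p ps; have [_ _ <-] := s_code p' p's; congr rep.
have near p0 : mdist p0 x < 5 * h -> forall i, (absz (Z p0 i - Z x i) <= D)%N.
  move=> p0x; apply: Z_le; rewrite (le_trans (ltW p0x))//.
  by rewrite /a /D natrM -mulrA [X in _ <= _ * X]mulrC divfK ?pnatr_eq0.
apply/ffunP => i; rewrite !ffunE; congr inord; congr (absz (_ + _)).
have := cell_code_inj (near _ px) (near _ p'x) pp' i; lia.
Qed.

End euclidean_nets.

Theorem corollary2 (R : realType) (d : nat) (M : set (euclidean R d)) (o : M) :
  dunford_pettis (free_space o).
Proof.
move=> x f x0 f0; have [q nets] := euclidean_uniform_nets o.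
have [x_null [A xA]] := weakly_null_free x0.
have [f_null [B fB]] := weakly_null_restrict f0.
under eq_fun do rewrite restrictE.
exact: (free_pairing_null nets (fun n => free_valP (x n)) xA x_null f_null fB).
Qed.
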